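(* Let $A$ be a $\Delta^0_2$ set and let $C_0,C_1,\ldots$ be uniformly $\Delta^0_2$ sets, each noncomputable (i.e., $C_i>_T 0$ for all $i$). Then either $A$ or $\overline{A}$ has an infinite $\Delta^0_2$ subset $X$ such that $C_i\not\leq_T X$ for all $i$.
   Context: Sets $C_0,C_1,\ldots$ are uniformly $\Delta^0_2$ if there is a single $0'$-computable procedure computing $C_i(n)$ from $i,n$. *)

(* Defs.v *)
From mathcomp Require Import all_boot.
Set Implicit Arguments. Unset Strict Implicit. Unset Printing Implicit Defensive.

(* Bijective pairing nat * nat -> nat: <a,b> = 2^a (2b+1) - 1. *)
Definition npair (a b : nat) : nat := (2 ^ a * b.*2.+1).-1.
Definition nfst (n : nat) : nat := logn 2 n.+1.
Definition nsnd (n : nat) : nat := ((n.+1 %/ 2 ^ nfst n).-1)./2.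

(* Syntax of oracle partial recursive functions (unary, using pairing). *)
Inductive code : Type :=
| CZero
| CSucc
| CId
| CFst
| CSnd
| COracle
| CPair (f g : code)
| CComp (f g : code)
| CPrim (f g : code)
| CMu (f : code).

(* Goedel numbering of codes (injective since npair is). *)
Fixpoint encode (c : code) : nat :=
  match c with
  | CZero => npair 0 0
  | CSucc => npair 1 0
  | CId => npair 2 0
  | CFst => npair 3 0
  | CSnd => npair 4 0
  | COracle => npair 5 0
  | CPair f g => npair 6 (npair (encode f) (encode g))
  | CComp f g => npair 7 (npair (encode f) (encode g))
  | CPrim f g => npair 8 (npair (encode f) (encode g))
  | CMu f => npair 9 (encode f)
  end.

Inductive eval (O : nat -> Prop) : code -> nat -> nat -> Prop :=
| ev_zero x : eval O CZero x 0
| ev_succ x : eval O CSucc x x.+1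
| ev_id x : eval O CId x x
| ev_fst x : eval O CFst x (nfst x)
| ev_snd x : eval O CSnd x (nsnd x)
| ev_orac1 x : O x -> eval O COracle x 1
| ev_orac0 x : ~ O x -> eval O COracle x 0
| ev_pair f g x a b : eval O f x a -> eval O g x b -> eval O (CPair f g) x (npair a b)
| ev_comp f g x z y : eval O g x z -> eval O f z y -> eval O (CComp f g) x y
| ev_prim0 f g x y : eval O f x y -> eval O (CPrim f g) (npair x 0) y
| ev_primS f g x n z y : eval O (CPrim f g) (npair x n) z ->
    eval O g (npair x (npair n z)) y -> eval O (CPrim f g) (npair x n.+1) y
| ev_mu f x n : eval O f (npair x n) 0 ->
    (forall m, m < n -> exists k, eval O f (npair x m) k.+1) ->
    eval O (CMu f) x n.

Definition turing_le (A B : nat -> Prop) : Prop :=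
  exists c, forall n, (A n -> eval B c n 1) /\ (~ A n -> eval B c n 0).

Definition empty_set : nat -> Prop := fun _ => False.

Definition noncomputable (C : nat -> Prop) : Prop := ~ turing_le C empty_set.

Definition halting_set : nat -> Prop :=
  fun n => exists c, encode c = n /\ exists y, eval empty_set c n y.

Definition delta02 (A : nat -> Prop) : Prop := turing_le A halting_set.

Definition uniformly_delta02 (C : nat -> nat -> Prop) : Prop :=
  exists c, forall i n, (C i n -> eval halting_set c (npair i n) 1) /\
                        (~ C i n -> eval halting_set c (npair i n) 0).

Definition infinite_set (X : nat -> Prop) : Prop :=
  forall m, exists n, m <= n /\ X n.

Definition subset_of (X A : nat -> Prop) : Prop := forall n, X n -> A n.

Definition complement (A : nat -> Prop) : nat -> Prop := fun n => ~ A n.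

(* Main.v *)
Require Import Defs.
From mathcomp Require Import all_boot.
From Stdlib Require Import Classical ClassicalEpsilon.
From mathcomp Require Import zify.
Set Implicit Arguments. Unset Strict Implicit. Unset Printing Implicit Defensive.

(** A red set inside [A] and a blue set inside its complement are built with oracle [0'], for requirements
    "the functional [e] does not compute [C_i]" and "there are at least [m] elements". A red requirement [r]
    is attacked together with a blue requirement [j] inside a reservoir. For inputs [n0], [n1] and values
    [v0], [v1] consider the partitions of the reservoir whose red part yields no red output [v0] at [n0] and
    whose blue part yields no blue output [v1] at [n1]: they form a Pi-0-1 class, so that [0'] decides whether
    there is one. As the sets [C_i] are not computable, some [n0], [n1] either admit no partition for the two
    wrong values, in which case the partition of the reservoir by [A] provides a wrong output that can be
    added to the red or to the blue set; or they admit a partition for the two right values, in which case its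
    red part becomes the new reservoir, on which [r] is met for good, and [r + 1] is attacked next with a
    new blue set. Should that red part turn out to be finite, the construction returns to the old reservoir,
    now almost contained in the blue part, on which [j] is met. If every red requirement is eventually passed
    then the red set is as desired; otherwise let [r] be the least one that is attacked infinitely often:
    the blue set attached to it is as desired.

    No element of a Pi-0-1 class is ever chosen: a condition only records the class, as a list of
    constraints on strings of levels (the level of a number tells which of the nested reservoirs contain it)
    together with an initial segment. This makes the construction computable in [0'] without any
    relativization to the reservoirs. *)

(** * Codings of data and closure properties of computable functions *)

Lemma npair_succ a b : (npair a b).+1 = 2 ^ a * b.*2.+1.
Proof. by rewrite /npair prednK // muln_gt0 expn_gt0. Qed.

Lemma nfst_npair a b : nfst (npair a b) = a.
Proof.
rewrite /nfst npair_succ lognM ?expn_gt0 // pfactorK //.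
by rewrite [X in _ + X]logn_coprime ?addn0 // coprime2n /= odd_double.
Qed.

Lemma nsnd_npair a b : nsnd (npair a b) = b.
Proof. by rewrite /nsnd nfst_npair npair_succ mulKn ?expn_gt0 //= doubleK. Qed.

Lemma npair_eta n : npair (nfst n) (nsnd n) = n.
Proof.
apply: succn_inj; rewrite npair_succ /nsnd.
have dv : 2 ^ nfst n %| n.+1 by apply: pfactor_dvdnn.
have o : odd (n.+1 %/ 2 ^ nfst n).
  rewrite -coprime2n.
  case: (@pfactor_coprime 2 n.+1 isT isT) => m cm E.
  by rewrite /nfst {1}E mulnK ?expn_gt0.
rewrite -[RHS](divnK dv) [RHS]mulnC; congr (_ * _).
move: o; set m := _ %/ _ => o.
have m0 : 0 < m by case: m o.
rewrite -[RHS](prednK m0); congr _.+1.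
have e : ~~ odd m.-1 by move: o; rewrite -{1}(prednK m0).
by rewrite -[RHS]odd_double_half (negbTE e).
Qed.

Lemma npair_inj a b a' b' : npair a b = npair a' b' -> a = a' /\ b = b'.
Proof. by move=> E; split; [rewrite -(nfst_npair a b) E nfst_npair | rewrite -(nsnd_npair a b) E nsnd_npair]. Qed.

Lemma nsnd_le n : nsnd n <= n.
Proof.
rewrite -{2}(npair_eta n) -ltnS npair_succ.
move: (nfst n) (nsnd n) => a b.
have := expn_gt0 2 a; nia.
Qed.

(** A bijection with the numbers rather than an injection: every number codes an element, so that a
    search over [T] is a search over [nat], and [enc] and [dec] are both computed by the identity
    code. *)
Class coded (T : Type) :=
  Coded { enc : T -> nat; dec : nat -> T; encK : cancel enc dec; decK : cancel dec enc }.

#[export] Instance coded_nat : coded nat :=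
  @Coded nat id id (fun=> erefl) (fun=> erefl).

Section CodedInstances.
Context {T U : Type} {cT : coded T} {cU : coded U}.

Definition enc_prod (x : T * U) := npair (enc x.1) (enc x.2).
Definition dec_prod n : T * U := (dec (nfst n), dec (nsnd n)).

Lemma enc_prodK : cancel enc_prod dec_prod.
Proof. by case=> a b; rewrite /dec_prod nfst_npair nsnd_npair !encK. Qed.

Lemma dec_prodK : cancel dec_prod enc_prod.
Proof. by move=> n; rewrite /enc_prod !decK npair_eta. Qed.

Fixpoint enc_seq (s : seq T) :=
  if s is x :: s' then (npair (enc x) (enc_seq s')).+1 else 0.

(** The call on [nsnd n'] is not structural; as [nsnd n' <= n'], the fuel [n] is enough. *)
Fixpoint dec_fuel m n : seq T :=
  if m is m'.+1 then
    if n is n'.+1 then dec (nfst n') :: dec_fuel m' (nsnd n') else [::]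
  else [::].

Lemma dec_fuelK m n : n <= m -> enc_seq (dec_fuel m n) = n.
Proof.
elim: m n => [|m IH] [|n] //= le; rewrite decK IH ?npair_eta //.
exact: leq_trans (nsnd_le n) _.
Qed.

Lemma enc_seq_inj : injective enc_seq.
Proof.
elim=> [|x s IH] [|y t] //= [] /npair_inj [E /IH ->].
by rewrite -(encK x) E encK.
Qed.

Definition dec_seq n := dec_fuel n n.

Lemma dec_seqK : cancel dec_seq enc_seq.
Proof. by move=> n; apply: dec_fuelK. Qed.

Lemma enc_seqK : cancel enc_seq dec_seq.
Proof. by move=> s; apply: enc_seq_inj; rewrite dec_seqK. Qed.
End CodedInstances.

#[export] Instance coded_prod {T U} {cT : coded T} {cU : coded U} : coded (T * U) :=
  Coded enc_prodK dec_prodK.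
#[export] Instance coded_seq {T} {cT : coded T} : coded (seq T) :=
  Coded enc_seqK dec_seqK.

Lemma enc_inj {T} {cT : coded T} : injective (@enc T cT).
Proof. exact: can_inj encK. Qed.

(** * Functions between coded types that are computable with an oracle *)

Section Computable.
Variable O : nat -> Prop.

Definition computable {T U} {cT : coded T} {cU : coded U} (f : T -> U) :=
  exists c, forall x, eval O c (enc x) (enc (f x)).

Section Basic.
Context {T U V W : Type} {cT : coded T} {cU : coded U} {cV : coded V} {cW : coded W}.

Lemma comp_ext (f g : T -> U) : f =1 g -> computable f -> computable g.
Proof. by move=> E [c H]; exists c => x; rewrite -E. Qed.

Lemma comp_id : computable (fun x : T => x).
Proof. by exists CId => x; constructor. Qed.

Lemma comp_comp (f : U -> V) (g : T -> U) : computable f -> computable g -> computable (fun x => f (g x)).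
Proof. by move=> [c H] [d K]; exists (CComp c d) => x; apply: ev_comp (K x) (H _). Qed.

Lemma comp_pair (f : T -> U) (g : T -> V) : computable f -> computable g -> computable (fun x => (f x, g x)).
Proof. by move=> [c H] [d K]; exists (CPair c d) => x; apply: ev_pair. Qed.

Lemma comp_fst (f : T -> U * V) : computable f -> computable (fun x => (f x).1).
Proof.
move=> [c H]; exists (CComp CFst c) => x; apply: ev_comp (H x) _.
rewrite -[in X in eval _ _ _ X](nfst_npair (enc (f x).1) (enc (f x).2)); exact: ev_fst.
Qed.

Lemma comp_snd (f : T -> U * V) : computable f -> computable (fun x => (f x).2).
Proof.
move=> [c H]; exists (CComp CSnd c) => x; apply: ev_comp (H x) _.
rewrite -[in X in eval _ _ _ X](nsnd_npair (enc (f x).1) (enc (f x).2)); exact: ev_snd.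
Qed.

Definition const_code n := iter n (CComp CSucc) CZero.

Lemma eval_const n x : eval O (const_code n) x n.
Proof. by elim: n => [|n IH]; [apply: ev_zero | apply: ev_comp IH _; apply: ev_succ]. Qed.

Lemma comp_cst (a : U) : computable (fun _ : T => a).
Proof. by exists (const_code (enc a)) => x; apply: eval_const. Qed.

Lemma comp_S (f : T -> nat) : computable f -> computable (fun x => (f x).+1).
Proof. by move=> [c H]; exists (CComp CSucc c) => x; apply: ev_comp (H x) _; apply: ev_succ. Qed.

Lemma comp_rec0 (g : T -> U) (h : T -> nat -> U -> U) :
  computable g -> computable (fun y : T * (nat * U) => h y.1 y.2.1 y.2.2) ->
  computable (fun x : T * nat => nat_rect (fun=> U) (g x.1) (h x.1) x.2).
Proof.
move=> [c H] [d K]; exists (CPrim c d) => -[x n] /=.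
elim: n => [|n IH]; first exact: ev_prim0.
by apply: ev_primS IH _; apply: (K (x, (n, _))).
Qed.

Lemma comp_enc : computable (@enc T cT).
Proof. by exists CId => x; apply: ev_id. Qed.

Lemma comp_dec : computable (@dec T cT).
Proof. by exists CId => x; rewrite decK; apply: ev_id. Qed.
End Basic.

Section Basic2.
Context {T U V W : Type} {cT : coded T} {cU : coded U} {cV : coded V} {cW : coded W}.

Lemma comp_rec (n : T -> nat) (g : T -> U) (h : T -> nat -> U -> U) :
  computable n -> computable g -> computable (fun y : T * (nat * U) => h y.1 y.2.1 y.2.2) ->
  computable (fun x => nat_rect (fun=> U) (g x) (h x) (n x)).
Proof.
move=> cn cg ch.
exact: (comp_comp (comp_rec0 cg ch) (comp_pair comp_id cn)).
Qed.

Lemma comp_cons (f : T -> U) (s : T -> seq U) :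
  computable f -> computable s -> computable (fun x => f x :: s x).
Proof.
move=> cf cs; have [c H] := comp_pair cf cs.
by exists (CComp CSucc c) => x; apply: ev_comp (H x) _; apply: ev_succ.
Qed.
End Basic2.


Lemma comp_fst0 {T U} {cT : coded T} {cU : coded U} : computable (@fst T U).
Proof. exact: comp_fst comp_id. Qed.

Lemma comp_snd0 {T U} {cT : coded T} {cU : coded U} : computable (@snd T U).
Proof. exact: comp_snd comp_id. Qed.

Lemma comp_pred {T} {cT : coded T} (f : T -> nat) : computable f -> computable (fun x => (f x).-1).
Proof.
move=> cf; apply: (@comp_ext _ _ _ _ (fun x => nat_rect (fun=> nat) 0 (fun n _ => n) (f x))).
  by move=> x; case: (f x).
by apply: comp_rec cf (comp_cst 0) _; apply: comp_fst; apply: comp_snd; apply: comp_id.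
Qed.
End Computable.

Arguments comp_enc {O T cT}.
Arguments comp_dec {O T cT}.
Arguments comp_id {O T cT}.

Ltac comp_step :=
  match goal with
  | |- computable _ (fun _ => ?a) => apply: comp_cst
  | |- computable _ (fun x => x) => apply: comp_id
  | |- computable _ (fun x => fst _) => apply: comp_fst
  | |- computable _ (fun x => snd _) => apply: comp_snd
  | |- computable _ (fun x => pair _ _) => apply: comp_pair
  | |- computable _ (fun x => S _) => apply: comp_S
  | |- computable _ (fun x => predn _) => apply: comp_pred
  | |- computable _ (fun x => cons _ _) => apply: comp_cons
  | |- computable _ (fun x => nat_rect _ _ _ _) => apply: comp_rec
  | |- computable _ fst => apply: comp_fst0
  | |- computable _ snd => apply: comp_snd0
  | H : computable _ ?f |- computable _ (fun x => ?f _) => apply: (comp_comp H)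
  | H : computable _ ?f |- computable _ ?f => exact: H
  end.
Ltac comp := repeat (cbv beta; comp_step).

Section Arith.
Context {O : nat -> Prop}.
Local Notation computable f := (computable O f).

Lemma comp_add {T} {cT : coded T} (f g : T -> nat) : computable f -> computable g -> computable (fun x => f x + g x).
Proof.
move=> cf cg; apply: (@comp_ext _ _ _ _ _ (fun x => nat_rect (fun=> nat) (f x) (fun _ z => z.+1) (g x))).
  by move=> x; elim: (g x) => [|n /= ->]; rewrite ?addn0 ?addnS.
by comp.
Qed.

Lemma comp_sub {T} {cT : coded T} (f g : T -> nat) : computable f -> computable g -> computable (fun x => f x - g x).
Proof.
move=> cf cg; apply: (@comp_ext _ _ _ _ _ (fun x => nat_rect (fun=> nat) (f x) (fun _ z => z.-1) (g x))).
  by move=> x; elim: (g x) => [|n /= ->]; rewrite ?subn0 ?subnS.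
by comp.
Qed.

Lemma comp_mul {T} {cT : coded T} (f g : T -> nat) : computable f -> computable g -> computable (fun x => f x * g x).
Proof.
move=> cf cg; apply: (@comp_ext _ _ _ _ _ (fun x => nat_rect (fun=> nat) 0 (fun _ z => f x + z) (g x))).
  by move=> x; elim: (g x) => [|n /= ->]; rewrite ?muln0 ?mulnS.
by comp; apply: comp_add; comp.
Qed.
End Arith.

Lemma comp_nfst {O T} {cT : coded T} (f : T -> nat) : computable O f -> computable O (fun x => nfst (f x)).
Proof. by move=> [c H]; exists (CComp CFst c) => x; apply: ev_comp (H x) _; apply: ev_fst. Qed.

Lemma comp_nsnd {O T} {cT : coded T} (f : T -> nat) : computable O f -> computable O (fun x => nsnd (f x)).
Proof. by move=> [c H]; exists (CComp CSnd c) => x; apply: ev_comp (H x) _; apply: ev_snd. Qed.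

Lemma comp_mu {O T} {cT : coded T} (f : T -> nat -> nat) (g : T -> nat) :
  computable O (fun x : T * nat => f x.1 x.2) ->
  (forall x, f x (g x) = 0) -> (forall x m, m < g x -> f x m <> 0) -> computable O g.
Proof.
move=> [c H] g0 gm; exists (CMu c) => x; apply: ev_mu.
  by have := H (x, g x); rewrite /= g0.
move=> m /gm; have := H (x, m); rewrite /=; case: (f x m) => // k Hk _.
by exists k.
Qed.

Lemma nfst0 : nfst 0 = 0. Proof. exact: (nfst_npair 0 0). Qed.
Lemma nsnd0 : nsnd 0 = 0. Proof. exact: (nsnd_npair 0 0). Qed.

Lemma comp_behead {O T U} {cT : coded T} {cU : coded U} (s : T -> seq U) :
  computable O s -> computable O (fun x => behead (s x)).
Proof.
move=> cs; have [c H] := comp_nsnd (comp_pred (comp_comp comp_enc cs)).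
exists c => x; move: (H x); congr eval.
by case: (s x) => [|y l] /=; rewrite ?nsnd0 // nsnd_npair.
Qed.

(** The default value is [dec 0] because on the empty sequence, of code 0, the predecessor and then
    [nfst] return 0. *)
Lemma comp_head {O T U} {cT : coded T} {cU : coded U} (s : T -> seq U) :
  computable O s -> computable O (fun x => head (dec 0) (s x)).
Proof.
move=> cs; apply: (comp_ext _ (comp_comp comp_dec (comp_nfst (comp_pred (comp_comp comp_enc cs))))) => x.
by case: (s x) => [|y l] /=; rewrite ?nfst0 // nfst_npair encK.
Qed.

Lemma comp_drop {O T U} {cT : coded T} {cU : coded U} (n : T -> nat) (s : T -> seq U) :
  computable O n -> computable O s -> computable O (fun x => drop (n x) (s x)).
Proof.
move=> cn cs; apply: (@comp_ext _ _ _ _ _ (fun x => nat_rect (fun=> seq U) (s x) (fun _ z => behead z) (n x))).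
  by move=> x; elim: (n x) => [|m /= ->]; rewrite ?drop0 // -drop1 drop_drop add1n.
by comp; apply: comp_behead; comp.
Qed.

Lemma comp_nth {O T U} {cT : coded T} {cU : coded U} (n : T -> nat) (s : T -> seq U) :
  computable O n -> computable O s -> computable O (fun x => nth (dec 0) (s x) (n x)).
Proof.
move=> cn cs; apply: comp_ext (comp_head (comp_drop cn cs)) => x.
by rewrite -nth0 nth_drop addn0.
Qed.

(** The size is the least [n] for which dropping [n] elements leaves the empty sequence, the only
    one of code 0. *)
Lemma comp_size {O T U} {cT : coded T} {cU : coded U} (s : T -> seq U) :
  computable O s -> computable O (fun x => size (s x)).
Proof.
move=> cs; apply: (@comp_mu _ _ _ (fun x n => enc (drop n (s x)))).
- apply: (comp_comp comp_enc); apply: comp_drop; comp.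
- by move=> x; rewrite drop_size.
- move=> x m lt E; have d : drop m (s x) = [::] by apply: enc_inj; rewrite E.
  by have := size_drop m (s x); rewrite d /=; lia.
Qed.

Lemma comp_app2 {O T A B U} {cT : coded T} {cA : coded A} {cB : coded B} {cU : coded U}
    (h : A -> B -> U) (a : T -> A) (b : T -> B) :
  computable O (fun y : A * B => h y.1 y.2) -> computable O a -> computable O b ->
  computable O (fun x => h (a x) (b x)).
Proof. by move=> ch ca cb; apply: (comp_comp ch (comp_pair ca cb)). Qed.

Lemma comp_app3 {O T A B C U} {cT : coded T} {cA : coded A} {cB : coded B} {cC : coded C} {cU : coded U}
    (h : A -> B -> C -> U) (a : T -> A) (b : T -> B) (c : T -> C) :
  computable O (fun y : A * (B * C) => h y.1 y.2.1 y.2.2) ->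
  computable O a -> computable O b -> computable O c ->
  computable O (fun x => h (a x) (b x) (c x)).
Proof. by move=> ch ca cb cc; apply: (comp_comp ch (comp_pair ca (comp_pair cb cc))). Qed.

Lemma comp_foldr {O T U V} {cT : coded T} {cU : coded U} {cV : coded V}
    (h : T -> U -> V -> V) (z : T -> V) (s : T -> seq U) :
  computable O s -> computable O z -> computable O (fun y : T * (U * V) => h y.1 y.2.1 y.2.2) ->
  computable O (fun x => foldr (h x) (z x) (s x)).
Proof.
move=> cs cz ch.
(* The recursion consumes the sequence from its end: after [m] rounds the last [m] elements are
   folded. *)
apply: (@comp_ext _ _ _ _ _ (fun x => nat_rect (fun=> V) (z x)
  (fun m a => h x (nth (dec 0) (s x) (size (s x) - m.+1)) a) (size (s x)))).
  move=> x; pose F m a := h x (nth (@dec U cU 0) (s x) (size (s x) - m.+1)) a.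
  suff H n : n <= size (s x) ->
    nat_rect (fun=> V) (z x) F n = foldr (h x) (z x) (drop (size (s x) - n) (s x)).
    by have := H _ (leqnn _); rewrite subnn drop0.
  elim: n => [|m IH] le /=; first by rewrite subn0 drop_size.
  rewrite IH; last by lia.
  rewrite [in RHS](drop_nth (dec 0) (n := size (s x) - m.+1)); last by lia.
  by rewrite /= subnSK.
apply: comp_rec => //; first exact: comp_size.
apply: (comp_app3 ch); comp; apply: comp_nth; comp.
by apply: comp_sub; comp; apply: comp_size; comp.
Qed.

Lemma comp_cat {O T U} {cT : coded T} {cU : coded U} (s t : T -> seq U) :
  computable O s -> computable O t -> computable O (fun x => s x ++ t x).
Proof.
move=> cs ct; apply: (@comp_ext _ _ _ _ _ (fun x => foldr cons (t x) (s x))).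
  by move=> x; elim: (s x) => //= a l ->.
by apply: (comp_foldr (h := fun _ => cons)) => //; comp.
Qed.

Lemma comp_map {O T U V} {cT : coded T} {cU : coded U} {cV : coded V} (f : T -> U -> V) (s : T -> seq U) :
  computable O (fun y : T * U => f y.1 y.2) -> computable O s -> computable O (fun x => [seq f x y | y <- s x]).
Proof.
move=> cf cs; apply: (@comp_ext _ _ _ _ _ (fun x => foldr (fun a l => f x a :: l) [::] (s x))).
  by move=> x; elim: (s x) => //= a l ->.
apply: (comp_foldr (h := fun x a l => f x a :: l)) => //; comp.
by apply: (comp_app2 cf); comp.
Qed.

Lemma comp_flatten {O T U} {cT : coded T} {cU : coded U} (s : T -> seq (seq U)) : computable O s -> computable O (fun x => flatten (s x)).
Proof.
move=> cs; apply: (comp_foldr (h := fun _ => cat)) => //; comp.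
by apply: comp_cat; comp.
Qed.

Lemma comp_nseq {O T U} {cT : coded T} {cU : coded U} (n : T -> nat) (a : T -> U) :
  computable O n -> computable O a -> computable O (fun x => nseq (n x) (a x)).
Proof.
move=> cn ca; apply: (@comp_ext _ _ _ _ _ (fun x => nat_rect (fun=> seq U) [::] (fun _ l => a x :: l) (n x))).
  by move=> x; elim: (n x) => //= m ->.
by comp.
Qed.

Lemma comp_iota {O T} {cT : coded T} (m n : T -> nat) :
  computable O m -> computable O n -> computable O (fun x => iota (m x) (n x)).
Proof.
move=> cm cn; apply: (@comp_ext _ _ _ _ _ (fun x => nat_rect (fun=> seq nat) [::]
   (fun i l => m x + (n x - i.+1) :: l) (n x))).
  move=> x; pose F i l := m x + (n x - i.+1) :: l.
  suff H i : i <= n x -> nat_rect (fun=> seq nat) [::] F i = iota (m x + (n x - i)) i.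
    by have := H _ (leqnn _); rewrite subnn addn0.
  elim: i => [|i IH] le //=.
  by rewrite IH -?addnS ?subnSK //; lia.
comp; apply: comp_add; comp; apply: comp_sub; comp.
Qed.

Lemma comp_nth0 {O T} {cT : coded T} (n : T -> nat) (s : T -> seq nat) :
  computable O n -> computable O s -> computable O (fun x => nth 0 (s x) (n x)).
Proof. exact: comp_nth. Qed.

Lemma comp_encf {O T U} {cT : coded T} {cU : coded U} (f : T -> U) :
  computable O f -> computable O (fun x => enc (f x)).
Proof. exact: comp_comp comp_enc. Qed.

Ltac comp_step2 :=
  match goal with
  | |- computable _ (fun x => addn _ _) => apply: comp_add
  | |- computable _ (fun x => subn _ _) => apply: comp_sub
  | |- computable _ (fun x => muln _ _) => apply: comp_mul
  | |- computable _ (fun x => size _) => apply: comp_size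
  | |- computable _ (fun x => nth _ _ _) => first [apply: comp_nth0 | apply: comp_nth]
  | |- computable _ (fun x => drop _ _) => apply: comp_drop
  | |- computable _ (fun x => cat _ _) => apply: comp_cat
  | |- computable _ (fun x => map _ _) => apply: comp_map
  | |- computable _ (fun x => foldr _ _ _) => apply: comp_foldr
  | |- computable _ (fun x => flatten _) => apply: comp_flatten
  | |- computable _ (fun x => nseq _ _) => apply: comp_nseq
  | |- computable _ (fun x => iota _ _) => apply: comp_iota
  | |- computable _ (fun x => nfst _) => apply: comp_nfst
  | |- computable _ (fun x => nsnd _) => apply: comp_nsnd
  | |- computable _ (fun x => enc _) => apply: comp_encf
  end.
Ltac comp ::= repeat (cbv beta; first [comp_step | comp_step2]).

Lemma comp_minn {O T} {cT : coded T} (f g : T -> nat) :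
  computable O f -> computable O g -> computable O (fun x => minn (f x) (g x)).
Proof.
move=> cf cg; apply: (@comp_ext _ _ _ _ _ (fun x => f x - (f x - g x))).
  by move=> x; lia.
by comp.
Qed.

(** * Strings over a finite alphabet, membership in lists and decidable predicates *)

Fixpoint strings (k m : nat) : seq (seq nat) :=
  if m is m'.+1 then
    flatten [seq [seq a :: s | a <- iota 0 k.+1] | s <- strings k m']
  else [:: [::]].

Lemma comp_strings {O T} {cT : coded T} (k m : T -> nat) :
  computable O k -> computable O m -> computable O (fun x => strings (k x) (m x)).
Proof.
move=> ck cm; apply: (@comp_ext _ _ _ _ _ (fun x => nat_rect (fun=> seq (seq nat)) [:: [::]]
  (fun _ L => flatten [seq [seq a :: s | a <- iota 0 (k x).+1] | s <- L]) (m x))).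
  by move=> x; elim: (m x) => //= n ->.
by comp.
Qed.

Lemma In_map {T U} (f : T -> U) s y : List.In y (map f s) <-> exists x, List.In x s /\ f x = y.
Proof.
elim: s => [|a s IH] /=; first by split=> // -[x []].
split=> [[<-|/IH [x [H <-]]] | [x [[->|H] E]]]; [by exists a; split; [left|] | | by left | ].
  by exists x; split; [right|].
by right; apply/IH; exists x.
Qed.

Lemma In_cat {T} (x : T) s t : List.In x (s ++ t) <-> List.In x s \/ List.In x t.
Proof. by elim: s => [|a s IH] /=; [intuition | rewrite IH; intuition]. Qed.

Lemma In_flatten {T} (x : T) ss : List.In x (flatten ss) <-> exists s, List.In s ss /\ List.In x s.
Proof.
elim: ss => [|s ss IH] /=; first by split=> // -[s []].
rewrite In_cat IH; split=> [[H|[t [H K]]] | [t [[->|H] K]]]; [by exists s; split; [left|] | | by left | ].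
  by exists t; split; [right|].
by right; exists t.
Qed.

Lemma In_iota x m n : List.In x (iota m n) <-> m <= x < m + n.
Proof. by elim: n m => [|n IH] m /=; [lia | rewrite IH; lia]. Qed.

Lemma stringsS k m :
  strings k m.+1 = flatten [seq [seq a :: s | a <- iota 0 k.+1] | s <- strings k m].
Proof. by []. Qed.

Lemma stringsP k m s : List.In s (strings k m) <-> size s = m /\ all (fun a => a <= k) s.
Proof.
elim: m s => [|m IH] s; first by split=> [[<-|[]] | [/size0nil -> _]] //; left.
rewrite stringsS; split.
  move=> /In_flatten [L [/In_map [t [/IH [st at_] <-]]]] /In_map [a [/In_iota ak <-]] /=.
  by rewrite st at_ andbT; split=> //; lia.
case: s => [[]|a s] //= [[E] /andP[ak /(conj E)/IH As]].
apply/In_flatten; exists [seq a :: s | a <- iota 0 k.+1]; split; first by apply/In_map; exists s.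
by apply/In_map; exists a; split=> //; apply/In_iota; lia.
Qed.

(** Truth is the value 0, which is what [CMu] searches for; conjunction becomes a sum and
    disjunction a product. *)
Definition decidable_in O {T} {cT : coded T} (P : T -> Prop) :=
  exists f : T -> nat, computable O f /\ forall x, P x <-> f x = 0.

Section Decidable.
Context {O : nat -> Prop} {T U : Type} {cT : coded T} {cU : coded U}.
Implicit Types P Q : T -> Prop.

Lemma decidable_ext P Q : (forall x, P x <-> Q x) -> decidable_in O P -> decidable_in O Q.
Proof. by move=> E [f [cf H]]; exists f; split=> // x; rewrite -E. Qed.

Lemma decidable_sub (P : U -> Prop) (f : T -> U) :
  decidable_in O P -> computable O f -> decidable_in O (fun x => P (f x)).
Proof. by move=> [g [cg H]] cf; exists (fun x => g (f x)); split=> [|x]; [comp | apply: H]. Qed.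

Lemma decidable_and P Q : decidable_in O P -> decidable_in O Q -> decidable_in O (fun x => P x /\ Q x).
Proof.
move=> [f [cf F]] [g [cg G]]; exists (fun x => f x + g x); split; first by comp.
by move=> x; rewrite F G; lia.
Qed.

Lemma decidable_or P Q : decidable_in O P -> decidable_in O Q -> decidable_in O (fun x => P x \/ Q x).
Proof.
move=> [f [cf F]] [g [cg G]]; exists (fun x => f x * g x); split; first by comp.
by move=> x; rewrite F G; nia.
Qed.

Lemma decidable_not P : decidable_in O P -> decidable_in O (fun x => ~ P x).
Proof.
move=> [f [cf F]]; exists (fun x => 1 - f x); split; first by comp.
by move=> x; rewrite F; lia.
Qed.

Lemma decidable_imp P Q : decidable_in O P -> decidable_in O Q -> decidable_in O (fun x => P x -> Q x).
Proof.
move=> dP dQ; apply: decidable_ext (decidable_or (decidable_not dP) dQ) => x.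
by case: (classic (P x)); intuition.
Qed.

Lemma decidable_eq (f g : T -> U) : computable O f -> computable O g -> decidable_in O (fun x => f x = g x).
Proof.
move=> cf cg; exists (fun x => (enc (f x) - enc (g x)) + (enc (g x) - enc (f x))); split; first by comp.
by move=> x; split=> [->|E]; [lia | apply: enc_inj; lia].
Qed.

Lemma decidable_leq (f g : T -> nat) : computable O f -> computable O g -> decidable_in O (fun x => f x <= g x).
Proof.
move=> cf cg; exists (fun x => f x - g x); split; first by comp.
by move=> x; lia.
Qed.

Lemma decidable_cst (p : Prop) : decidable_in O (fun _ : T => p).
Proof.
case: (classic p) => H; [exists (fun=> 0) | exists (fun=> 1)]; by split; [comp|].
Qed.

Lemma decidable_all_lt (P : T -> nat -> Prop) (n : T -> nat) :
  decidable_in O (fun z : T * nat => P z.1 z.2) -> computable O n ->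
  decidable_in O (fun x => forall y, y < n x -> P x y).
Proof.
move=> [f [cf F]] cn.
exists (fun x => nat_rect (fun=> nat) 0 (fun i a => a + f (x, i)) (n x)); split; first by comp.
move=> x; elim: (n x) => [|m IH] /=; first by split.
split=> [H|/eqP].
  have -> : f (x, m) = 0 by apply/F; apply: H.
  by rewrite addn0; apply/IH => y lt; apply: H; lia.
rewrite addn_eq0 => /andP[/eqP /IH H /eqP /F E] y.
by rewrite ltnS leq_eqVlt => /orP[/eqP -> | /H].
Qed.
End Decidable.

Section Quantifiers.
Context {O : nat -> Prop} {T U : Type} {cT : coded T} {cU : coded U}.

Lemma decidable_ex_lt (P : T -> nat -> Prop) (n : T -> nat) :
  decidable_in O (fun z : T * nat => P z.1 z.2) -> computable O n ->
  decidable_in O (fun x => exists y, y < n x /\ P x y).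
Proof.
move=> dP cn.
apply: decidable_ext (decidable_not (decidable_all_lt (P := fun x y => ~ P x y) (decidable_not dP) cn)) => x.
split=> [H | [y [lt Py]] H]; last exact: H lt Py.
by apply: NNPP => N; apply: H => y lt Py; apply: N; exists y.
Qed.

Lemma In_nth (d : U) x s : List.In x s <-> exists i, i < size s /\ nth d s i = x.
Proof.
elim: s => [|y s IH] /=; first by split=> // -[i []].
split=> [[->|/IH [i [lt E]]] | [[|i] [lt E]]]; [by exists 0 | by exists i.+1 | by left | right].
by apply/IH; exists i.
Qed.

Lemma decidable_all_In (P : T -> U -> Prop) (s : T -> seq U) :
  decidable_in O (fun z : T * U => P z.1 z.2) -> computable O s ->
  decidable_in O (fun x => forall y, List.In y (s x) -> P x y).
Proof.
move=> dP cs.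
apply: decidable_ext (decidable_all_lt (P := fun x i => P x (nth (dec 0) (s x) i))
  (n := fun x => size (s x)) _ _) => [x||]; last by comp.
  split=> H; first by move=> y /(In_nth (dec 0)) [i [lt <-]]; apply: H.
  by move=> i lt; apply: H; apply/(In_nth (dec 0)); exists i.
by apply: (decidable_sub (f := fun z : T * nat => (z.1, nth (dec 0) (s z.1) z.2)) dP); comp.
Qed.

Lemma decidable_ex_In (P : T -> U -> Prop) (s : T -> seq U) :
  decidable_in O (fun z : T * U => P z.1 z.2) -> computable O s ->
  decidable_in O (fun x => exists y, List.In y (s x) /\ P x y).
Proof.
move=> dP cs.
apply: decidable_ext (decidable_not (decidable_all_In (P := fun x y => ~ P x y) (decidable_not dP) cs)) => x.
split=> [H | [y [lt Py]] H]; last exact: H lt Py.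
by apply: NNPP => N; apply: H => y lt Py; apply: N; exists y.
Qed.

Lemma decidable_In (f : T -> U) (s : T -> seq U) :
  computable O f -> computable O s -> decidable_in O (fun x => List.In (f x) (s x)).
Proof.
move=> cf cs; apply: decidable_ext (decidable_ex_In (P := fun x y => f x = y) _ cs) => [x|].
  by split=> [[y [H ->]] | H] //; exists (f x).
by apply: decidable_eq; comp.
Qed.
End Quantifiers.

(** * Semidecidable predicates and the halting set *)

(* The automatic induction principle gives no hypothesis for the evaluations nested in the rule for [CMu]. *)
Fixpoint eval_nested_ind (O : nat -> Prop) (P : code -> nat -> nat -> Prop)
  (Hzero : forall x, P CZero x 0)
  (Hsucc : forall x, P CSucc x x.+1)
  (Hid : forall x, P CId x x)
  (Hfst : forall x, P CFst x (nfst x))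
  (Hsnd : forall x, P CSnd x (nsnd x))
  (Horac1 : forall x, O x -> P COracle x 1)
  (Horac0 : forall x, ~ O x -> P COracle x 0)
  (Hpair : forall f g x a b, P f x a -> P g x b -> P (CPair f g) x (npair a b))
  (Hcomp : forall f g x z y, P g x z -> P f z y -> P (CComp f g) x y)
  (Hprim0 : forall f g x y, P f x y -> P (CPrim f g) (npair x 0) y)
  (HprimS : forall f g x n z y, P (CPrim f g) (npair x n) z ->
     P g (npair x (npair n z)) y -> P (CPrim f g) (npair x n.+1) y)
  (Hmu : forall f x n, P f (npair x n) 0 ->
     (forall m, m < n -> exists k, P f (npair x m) k.+1) -> P (CMu f) x n)
  c x y (e : eval O c x y) {struct e} : P c x y :=
  let IH := @eval_nested_ind O P Hzero Hsucc Hid Hfst Hsnd Horac1 Horac0 Hpair Hcomp Hprim0 HprimS Hmu in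
  match e with
  | ev_zero x => Hzero x
  | ev_succ x => Hsucc x
  | ev_id x => Hid x
  | ev_fst x => Hfst x
  | ev_snd x => Hsnd x
  | ev_orac1 x H => Horac1 x H
  | ev_orac0 x H => Horac0 x H
  | ev_pair f g x a b ef eg => Hpair _ _ _ _ _ (IH _ _ _ ef) (IH _ _ _ eg)
  | ev_comp f g x z y eg ef => Hcomp _ _ _ _ _ (IH _ _ _ eg) (IH _ _ _ ef)
  | ev_prim0 f g x y ef => Hprim0 _ g _ _ (IH _ _ _ ef)
  | ev_primS f g x n z y e1 e2 => HprimS _ _ _ _ _ _ (IH _ _ _ e1) (IH _ _ _ e2)
  | ev_mu f x n e0 H => Hmu _ _ _ (IH _ _ _ e0)
      (fun m lt => match H m lt with ex_intro k ek => ex_intro _ k (IH _ _ _ ek) end)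
  end.

Lemma eval_det O c x y : eval O c x y -> forall y', eval O c x y' -> y = y'.
Proof.
move: c x y; apply: (@eval_nested_ind O); try by [move=> ? ? e; inversion e].
- by move=> x Ox y e; inversion e.
- by move=> x Ox y e; inversion e.
- by move=> f g x a b IHf IHg y e; inversion e; subst; congr npair; auto.
- move=> f g x z y IHg IHf y' e; inversion e as [| | | | | | | |? ? ? z' ? eg ef| | |]; subst.
  by apply: IHf; rewrite (IHg z').
- move=> f g x y IH y' e; inversion e; subst;
    match goal with E : npair _ _ = npair _ _ |- _ => move: E => /npair_inj [E1 E2] end => //.
  by subst; apply: IH.
- move=> f g x n z y IH1 IH2 y' e; inversion e; subst;
    match goal with E : npair _ _ = npair _ _ |- _ => move: E => /npair_inj [E1 E2] end => //.
  case: E2 => E2; subst; apply: IH2.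
  match goal with E : eval _ (CPrim _ _) _ ?z' |- _ => by rewrite (IH1 z' E) end.
- move=> f x n IH0 IHm y' e; inversion e as [| | | | | | | | | | |? ? ? e0 em]; subst.
  case: (ltngtP n y') => // lt.
    by have [k /IH0] := em _ lt.
  by have [k /(_ _ e0)] := IHm _ lt.
Qed.

Lemma encode_inj : injective encode.
Proof.
elim=> [||||||f IHf g IHg|f IHf g IHg|f IHf g IHg|f IHf]; case=> [||||||f' g'|f' g'|f' g'|f'] //=;
  move=> /npair_inj [] // _; try by move=> /npair_inj [/IHf -> /IHg ->].
by move=> /IHf ->.
Qed.

Lemma least (P : nat -> Prop) : (exists n, P n) -> exists n, P n /\ forall m, m < n -> ~ P m.
Proof.
move=> [n Pn]; apply: NNPP => N; have H : forall m k, k < m -> ~ P k.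
  elim=> // m IH k; rewrite ltnS leq_eqVlt => /orP[/eqP -> Pm | /IH] //.
  by apply: N; exists m.
exact: H (ltnSn n) Pn.
Qed.

Definition semi O {T} {cT : coded T} (P : T -> Prop) :=
  exists R : T -> nat -> Prop,
    decidable_in O (fun z : T * nat => R z.1 z.2) /\ forall x, P x <-> exists k, R x k.

Section Semi.
Context {O : nat -> Prop} {T U : Type} {cT : coded T} {cU : coded U}.

Lemma semi_ext (P Q : T -> Prop) : (forall x, P x <-> Q x) -> semi O P -> semi O Q.
Proof. by move=> E [R [dR H]]; exists R; split=> // x; rewrite -E. Qed.

Lemma semi_decidable (P : T -> Prop) : decidable_in O P -> semi O P.
Proof.
move=> dP; exists (fun x _ => P x); split; last by move=> x; split=> [|[]] //; exists 0.
by apply: (decidable_sub dP); comp.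
Qed.

Lemma semi_sub (P : U -> Prop) (f : T -> U) : semi O P -> computable O f -> semi O (fun x => P (f x)).
Proof.
move=> [R [dR H]] cf; exists (fun x k => R (f x) k); split=> [|x]; last exact: H.
by apply: (decidable_sub (f := fun z : T * nat => (f z.1, z.2)) dR); comp.
Qed.

Lemma semi_ex (P : T -> U -> Prop) :
  semi O (fun z : T * U => P z.1 z.2) -> semi O (fun x => exists y, P x y).
Proof.
move=> [R [dR H]]; exists (fun x k => R (x, dec (nfst k)) (nsnd k)); split.
  apply: (decidable_sub (f := fun z : T * nat => ((z.1, dec (nfst z.2)), nsnd z.2)) dR); comp.
  by apply: comp_comp comp_dec _; comp.
move=> x; split=> [[y /(H (x, y)) [k Rk]]|[k Rk]].
  by exists (npair (enc y) k); rewrite nfst_npair nsnd_npair encK.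
by exists (dec (nfst k)); apply/(H (x, _)); exists (nsnd k).
Qed.

Lemma semi_and (P Q : T -> Prop) : semi O P -> semi O Q -> semi O (fun x => P x /\ Q x).
Proof.
move=> [R [dR HR]] [S [dS HS]]; exists (fun x k => R x (nfst k) /\ S x (nsnd k)); split.
  apply: decidable_and.
    by apply: (decidable_sub (f := fun z : T * nat => (z.1, nfst z.2)) dR); comp.
  by apply: (decidable_sub (f := fun z : T * nat => (z.1, nsnd z.2)) dS); comp.
move=> x; rewrite HR HS; split=> [[[k Rk] [l Sl]]|[k [Rk Sk]]].
  by exists (npair k l); rewrite nfst_npair nsnd_npair.
by split; [exists (nfst k)|exists (nsnd k)].
Qed.

Lemma semi_or (P Q : T -> Prop) : semi O P -> semi O Q -> semi O (fun x => P x \/ Q x).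
Proof.
move=> [R [dR HR]] [S [dS HS]]; exists (fun x k => R x k \/ S x k); split; first exact: decidable_or.
move=> x; rewrite HR HS; split=> [[[k Rk]|[l Sl]]|[k [Rk|Sk]]].
- by exists k; left.
- by exists l; right.
- by left; exists k.
- by right; exists k.
Qed.

(** A value and a stage confirming it are searched together; as only [f x] is ever confirmed, the
    first value found is the right one. *)
Lemma semi_graph (f : T -> U) (Q : T -> U -> Prop) :
  semi O (fun z : T * U => Q z.1 z.2) ->
  (forall x, Q x (f x)) -> (forall x y, Q x y -> y = f x) -> computable O f.
Proof.
move=> [R [[r [cr Hr]] HR]] Qf Qu.
have L x : exists m, r ((x, dec (nfst m)), nsnd m) = 0 /\
    forall m', m' < m -> r ((x, dec (nfst m')), nsnd m') <> 0.
  apply: (@least (fun m => r ((x, dec (nfst m)), nsnd m) = 0)).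
  have /(HR (x, f x)) [k Rk] := Qf x; exists (npair (enc (f x)) k).
  by rewrite nfst_npair nsnd_npair encK; apply/(Hr ((x, f x), k)).
(* [epsilon] merely names the least successful pair, which [comp_mu] finds by search. *)
pose g x := epsilon (inhabits 0) (fun m => r ((x, @dec U cU (nfst m)), nsnd m) = 0 /\
    forall m', m' < m -> r ((x, @dec U cU (nfst m')), nsnd m') <> 0).
have gP x := epsilon_spec (inhabits 0) _ (L x).
apply: (@comp_ext O T U _ _ (fun x => dec (nfst (g x)))) => [x|].
  apply: Qu; apply/(HR (x, _)); exists (nsnd (g x)).
  by apply/(Hr ((x, _), _)); exact: (gP x).1.
apply: (comp_comp comp_dec); apply: comp_nfst.
apply: (comp_mu (f := fun x m => r ((x, dec (nfst m)), nsnd m))) => [|x|x m].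
- by comp; apply: (comp_comp comp_dec); comp.
- exact: (gP x).1.
- exact: (gP x).2.
Qed.
End Semi.

Section Chi.
Context {T : Type} {cT : coded T}.

Definition chi (P : T -> Prop) (x : T) : nat := if excluded_middle_informative (P x) then 1 else 0.

Lemma chi1 (P : T -> Prop) x : chi P x = 1 <-> P x.
Proof. by rewrite /chi; case: excluded_middle_informative. Qed.

Lemma chi0 (P : T -> Prop) x : chi P x = 0 <-> ~ P x.
Proof. by rewrite /chi; case: excluded_middle_informative. Qed.

Lemma chi_le1 (P : T -> Prop) x : chi P x <= 1.
Proof. by rewrite /chi; case: excluded_middle_informative. Qed.

Lemma computable_chi O (P : T -> Prop) : decidable_in O P <-> computable O (chi P).
Proof.
split=> [[f [cf H]]|c].
  apply: (@comp_ext _ _ _ _ _ (fun x => 1 - f x)); last by comp.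
  move=> x; case: (classic (P x)) => p.
    by rewrite (iffRL (chi1 _ _) p) (iffLR (H x) p).
  rewrite (iffRL (chi0 _ _) p).
  by have := iffRL (H x); case: (f x) => [/(_ erefl)|n _] //; lia.
exists (fun x => 1 - chi P x); split; first by comp.
by move=> x; rewrite -chi1; have := chi_le1 P x; lia.
Qed.
End Chi.

Lemma turing_le_computable A B : turing_le A B <-> computable B (chi A).
Proof.
split=> -[c H]; exists c => n.
  rewrite /chi; case: excluded_middle_informative => a; first exact: (H n).1.
  exact: (H n).2.
by split=> a; have := H n; rewrite ?(iffRL (chi1 _ _) a) ?(iffRL (chi0 _ _) a).
Qed.

Lemma computable_oracle O : computable O (chi O).
Proof. by apply/turing_le_computable; exists COracle => n; split=> H; constructor. Qed.

Lemma decidable_halting {T} {cT : coded T} (P : T -> Prop) :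
  semi empty_set P -> decidable_in halting_set P.
Proof.
move=> [R [[f [[c Hc] Hf]] HR]].
(* The halting set is diagonal: the program numbered [s x] runs on its own number. It discards this
   input and searches for a stage confirming [x] instead. *)
pose s x := encode (CComp (CMu c) (const_code (@enc T cT x))).
have E x : P x <-> halting_set (s x).
  rewrite HR; split=> [/least [k [Rk lt]] | [d [/encode_inj -> [y e]]]].
    exists (CComp (CMu c) (const_code (enc x))); split=> //; exists k.
    apply: ev_comp (eval_const _ _ _) _; apply: ev_mu.
      by have := Hc (x, k); rewrite (iffLR (Hf (x, k)) Rk).
    move=> m /lt Rm; have := Hc (x, m); have := iffRL (Hf (x, m)).
    by case: (f (x, m)) => [/(_ erefl)|j _ e] //; exists j.
  inversion e as [| | | | | | | |? ? ? z ? e1 e2| | |]; subst.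
  have E := eval_det (eval_const _ _ _) e1; subst.
  inversion e2 as [| | | | | | | | | | |? ? ? e0 em]; subst; exists y; apply/(Hf (x, y)).
  exact: (eval_det (Hc (x, y)) e0).
apply: (@decidable_ext _ _ _ (fun x => halting_set (s x))); first by move=> x; rewrite E.
apply: (@decidable_sub _ _ _ _ _ halting_set); first by apply/computable_chi/computable_oracle.
have comp_npair (a b : T -> nat) : computable halting_set a -> computable halting_set b ->
    computable halting_set (fun x => npair (a x) (b x)).
  by move=> ca cb; apply: (comp_encf (f := fun x => (a x, b x))); comp.
rewrite /s /=; apply: (comp_npair); first by comp.
apply: comp_npair; first by comp.
(* The number of a constant program is computed by recursion on the constant; 7 is the tag of
   [CComp] and [npair 1 0] the number of [CSucc]. *)
apply: (@comp_ext _ _ _ _ _ (fun x => nat_rect (fun=> nat) (npair 0 0)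
   (fun _ z => enc (7, (npair 1 0, z))) (enc x))).
  by move=> x; elim: (enc x) => //= n ->.
by comp; exact: comp_enc.
Qed.

Section Iteration.
Context {O : nat -> Prop} {T : Type} {cT : coded T}.

(* The search for a successor need only succeed on states satisfying the invariant. *)
Lemma computable_run (step : T -> T -> Prop) (inv : T -> Prop) (s0 : T) :
  semi O (fun z : T * T => step z.1 z.2) -> inv s0 ->
  (forall s, inv s -> exists s', step s s') ->
  (forall s s', inv s -> step s s' -> inv s') ->
  exists S : nat -> T, computable O S /\ S 0 = s0 /\ forall n, inv (S n) /\ step (S n) (S n.+1).
Proof.
move=> [R [[r [[c Hc] Hr]] HR]] i0 tot pres.
pose good s m := r ((s, @dec T cT (nfst m)), nsnd m) = 0 /\
    forall m', m' < m -> r ((s, @dec T cT (nfst m')), nsnd m') <> 0.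
have L s : inv s -> exists m, good s m.
  move=> /tot [s' /(HR (s, s')) [k Rk]].
  apply: (@least (fun m => r ((s, @dec T cT (nfst m)), nsnd m) = 0)).
  by exists (npair (enc s') k); rewrite nfst_npair nsnd_npair encK; apply/(Hr ((s, s'), k)).
pose w s := epsilon (inhabits 0) (good s).
have wP s : inv s -> good s (w s) by move=> /L /(epsilon_spec (inhabits 0)).
pose S n := iter n (fun s => @dec T cT (nfst (w s))) s0.
have stepS s : inv s -> step s (dec (nfst (w s))).
  by move=> /wP [e _]; apply/(HR (s, _)); exists (nsnd (w s)); apply/(Hr ((s, _), _)).
have invS n : inv (S n) by elim: n => //= n IH; apply: pres (stepS _ IH).
exists S; split; last by split=> // n; split; [|apply: stepS].
have [d Hd] : computable O (fun z : T * nat => r ((z.1, dec (nfst z.2)), nsnd z.2)).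
  have cr : computable O r by exists c.
  by comp; apply: (comp_comp comp_dec); comp.
(* The search may diverge where [inv] fails, so that [comp_rec], made for total functions, does not
   apply and the code is written out. Each round receives [npair 0 (npair n z)], from which
   [CComp CSnd CSnd] extracts the state [z]. *)
exists (CComp (CPrim (const_code (enc s0)) (CComp CFst (CComp (CMu d) (CComp CSnd CSnd)))) (CPair CZero CId)).
move=> n; apply: ev_comp; first by apply: ev_pair (ev_zero _ _) (ev_id _ _).
elim: n => [|n IH]; first by apply: ev_prim0; apply: eval_const.
apply: ev_primS IH _; rewrite /= decK -/(S n).
have [e lt] := wP _ (invS n).
apply: ev_comp; last exact: ev_fst.
apply: ev_comp.
  apply: ev_comp (ev_snd _ _) _; rewrite nsnd_npair; apply: ev_snd.
rewrite nsnd_npair; apply: ev_mu; first by have := Hd (S n, w (S n)); rewrite /= e.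
move=> m /lt; have := Hd (S n, m); rewrite /=; case: (r _) => // k H _; by exists k.
Qed.
End Iteration.

(** * Finite derivations of oracle computations *)

#[local] Opaque npair nfst nsnd.

Lemma decidable_sub2 {O T A B} {cT : coded T} {cA : coded A} {cB : coded B}
    (P : A -> B -> Prop) (a : T -> A) (b : T -> B) :
  decidable_in O (fun z : A * B => P z.1 z.2) -> computable O a -> computable O b ->
  decidable_in O (fun x => P (a x) (b x)).
Proof. by move=> dP ca cb; apply: (decidable_sub dP (comp_pair ca cb)). Qed.

Lemma decidable_sub3 {O T A B C} {cT : coded T} {cA : coded A} {cB : coded B} {cC : coded C}
    (P : A -> B -> C -> Prop) (a : T -> A) (b : T -> B) (c : T -> C) :
  decidable_in O (fun z : A * (B * C) => P z.1 z.2.1 z.2.2) ->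
  computable O a -> computable O b -> computable O c ->
  decidable_in O (fun x => P (a x) (b x) (c x)).
Proof. by move=> dP ca cb cc; apply: (decidable_sub dP (comp_pair ca (comp_pair cb cc))). Qed.

Ltac decide_step :=
  match goal with
  | |- decidable_in _ (fun _ => ?p) => apply: decidable_cst
  | |- decidable_in _ (fun x => _ /\ _) => apply: decidable_and
  | |- decidable_in _ (fun x => _ \/ _) => apply: decidable_or
  | |- decidable_in _ (fun x => ~ _) => apply: decidable_not
  | |- decidable_in _ (fun x => _ = _) => apply: decidable_eq
  | |- decidable_in _ (fun x => is_true (leq _ _)) => apply: decidable_leq
  | |- decidable_in _ (fun x => List.In _ _) => apply: decidable_In
  | |- decidable_in _ (fun x => ex _) => first [apply: decidable_ex_lt | apply: decidable_ex_In]
  | |- decidable_in _ (fun x => forall y, _) =>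
    first [apply: decidable_all_lt | apply: decidable_all_In | apply: decidable_imp]
  end.
Ltac deciding := repeat (cbv beta; first [decide_step | comp_step | comp_step2]).

Definition fact : Type := nat * (nat * nat).

(* A fact [(e, (x, y))] says that the code numbered [e] maps [x] to [y], and must follow from the facts of
   [D]; the oracle is the finite bit string [t], undefined beyond its length. *)
Definition follows (t : seq nat) (d : fact) (D : seq fact) : Prop :=
  (nfst d.1 = 0 /\ d.2.2 = 0) \/
  (nfst d.1 = 1 /\ d.2.2 = d.2.1.+1) \/
  (nfst d.1 = 2 /\ d.2.2 = d.2.1) \/
  (nfst d.1 = 3 /\ d.2.2 = nfst d.2.1) \/
  (nfst d.1 = 4 /\ d.2.2 = nsnd d.2.1) \/
  (nfst d.1 = 5 /\ d.2.1 < size t /\ d.2.2 = nth 0 t d.2.1) \/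
  (nfst d.1 = 6 /\ exists d1, List.In d1 D /\ exists d2, List.In d2 D /\
     d1.1 = nfst (nsnd d.1) /\ d1.2.1 = d.2.1 /\ d2.1 = nsnd (nsnd d.1) /\ d2.2.1 = d.2.1 /\
     d.2.2 = enc (d1.2.2, d2.2.2)) \/
  (nfst d.1 = 7 /\ exists d1, List.In d1 D /\
     d1.1 = nsnd (nsnd d.1) /\ d1.2.1 = d.2.1 /\ List.In (nfst (nsnd d.1), (d1.2.2, d.2.2)) D) \/
  (nfst d.1 = 8 /\ nsnd d.2.1 = 0 /\ List.In (nfst (nsnd d.1), (nfst d.2.1, d.2.2)) D) \/
  (nfst d.1 = 8 /\ 0 < nsnd d.2.1 /\ exists d1, List.In d1 D /\
     d1.1 = d.1 /\ d1.2.1 = enc (nfst d.2.1, (nsnd d.2.1).-1) /\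
     List.In (nsnd (nsnd d.1), (enc (nfst d.2.1, ((nsnd d.2.1).-1, d1.2.2)), d.2.2)) D) \/
  (nfst d.1 = 9 /\ List.In (nsnd d.1, (enc (d.2.1, d.2.2), 0)) D /\
     forall m, m < d.2.2 -> exists d1, List.In d1 D /\
       d1.1 = nsnd d.1 /\ d1.2.1 = enc (d.2.1, m) /\ 0 < d1.2.2).

(** The newest fact comes first and rests on those behind it, so that derivations can be
    concatenated and a conclusion put in front. *)
Fixpoint derivation (t : seq nat) (D : seq fact) : Prop :=
  if D is d :: D' then follows t d D' /\ derivation t D' else True.

Lemma decidable_follows O :
  decidable_in O (fun z : seq nat * (fact * seq fact) => follows z.1 z.2.1 z.2.2).
Proof. by rewrite /follows; deciding. Qed.

Lemma decidable_derivation O :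
  decidable_in O (fun z : seq nat * seq fact => derivation z.1 z.2).
Proof.
(* The recursion on the list is replaced by a bounded quantifier over its positions. *)
apply: (@decidable_ext _ _ _ (fun z => forall i, i < size z.2 ->
   follows z.1 (nth (dec 0) z.2 i) (drop i.+1 z.2))).
  move=> [t D] /=; elim: D => [|d D IH] /=; first by split.
  rewrite -IH; split=> [H|[H K] [|i] lt]; last exact: K.
    by split=> [|i lt]; [have := H 0 isT; rewrite drop0 | apply: (H i.+1)].
  by rewrite drop0.
deciding; apply: decidable_sub3; last by comp.
- exact: decidable_follows.
- by comp.
- by comp.
Qed.

Lemma follows_mono t t' d D D' :
  size t <= size t' -> (forall x, x < size t -> nth 0 t x = nth 0 t' x) ->
  (forall a, List.In a D -> List.In a D') -> follows t d D -> follows t' d D'.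
Proof.
move=> le E s; rewrite /follows => H; repeat (match type of H with _ \/ _ => case: H => H end); try by intuition.
- do 5 right; left; move: H => [-> [lt ->]]; rewrite E //; split=> //; split=> //; exact: leq_trans lt le.
- do 6 right; left; move: H => [-> [d1 [/s H1 [d2 [/s H2 H]]]]]; split=> //; exists d1; split=> //.
  by exists d2.
- do 7 right; left; move: H => [-> [d1 [/s H1 [? [? /s ?]]]]]; split=> //; exists d1; split=> //.
- do 9 right; left; move: H => [-> [? [d1 [/s H1 [? [? /s ?]]]]]]; split=> //; split=> //; exists d1; split=> //.
- do 10 right; move: H => [-> [/s ? H]]; split=> //; split=> // m /H [d1 [/s H1 ?]]; by exists d1.
Qed.

Lemma derivation_mono t t' D :
  size t <= size t' -> (forall x, x < size t -> nth 0 t x = nth 0 t' x) ->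
  derivation t D -> derivation t' D.
Proof. by move=> le E; elim: D => //= d D IH [/(follows_mono le E) F /IH ?]; split=> //; apply: F. Qed.

Lemma derivation_cat t D D' : derivation t D -> derivation t D' -> derivation t (D ++ D').
Proof.
elim: D => //= d D IH [F /IH H] /H K; split=> //.
by apply: follows_mono F => // a; rewrite In_cat; left.
Qed.

Definition agrees (X : nat -> Prop) (t : seq nat) (u : nat) : Prop :=
  u <= size t /\ forall x, x < u -> nth 0 t x = chi X x.

Lemma derivation_eval X t D : agrees X t (size t) -> derivation t D ->
  forall c x y, List.In (encode c, (x, y)) D -> eval X c x y.
Proof.
move=> [_ A]; elim: D => //= d D IH [F /IH {}IH] c x y [E|]; last exact: IH.
move: F; rewrite /follows E /= => F {d E}.
repeat (match type of F with _ \/ _ => case: F => F end); move: F => [tag F];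
  case: c tag F => [||||||f g|f g|f g|f]; rewrite /= nfst_npair // => _;
  rewrite ?nsnd_npair ?nfst_npair => F.
- by rewrite F; constructor.
- by rewrite F; constructor.
- by rewrite F; constructor.
- by rewrite F; constructor.
- by rewrite F; constructor.
- by move: F => [lt ->]; rewrite A // /chi; case: excluded_middle_informative => ?; constructor.
- move: F => [[e1 [x1 y1]] [I1 [[e2 [x2 y2]] [I2 /= [? [? [? [? ->]]]]]]]]; subst.
  by apply: ev_pair; apply: IH.
- by move: F => [[e1 [x1 y1]] [I1 /= [? [? I2]]]]; subst; apply: ev_comp (IH _ _ _ I1) (IH _ _ _ I2).
- by move: F => [z I]; rewrite -(npair_eta x) z; apply: ev_prim0; apply: IH.
- move: F => [z [[e1 [x1 y1]] [I1 /= [? [? I2]]]]]; subst.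
  have -> : x = npair (nfst x) (nsnd x).-1.+1 by rewrite prednK // npair_eta.
  exact: ev_primS (IH (CPrim f g) _ _ I1) (IH _ _ _ I2).
- move: F => [I H]; apply: ev_mu (IH _ _ _ I) _ => m /H [[e1 [x1 y1]] [I1 /= [? [? y0]]]]; subst.
  by exists y1.-1; rewrite prednK //; apply: IH.
Qed.

(** Completeness of derivations together with the use principle: [u] bounds the oracle positions
    consulted, so that the same [D] serves every bit string that is correct below [u]. *)
Lemma eval_derivation X c x y : eval X c x y ->
  exists u D, (forall t, agrees X t u -> derivation t D) /\ List.In (encode c, (x, y)) D.
Proof.
have agW t u u' : u' <= u -> agrees X t u -> agrees X t u'.
  by move=> le [l H]; split; [lia | move=> z lt; apply: H; lia].
have ax e z w : (forall t, follows t (e, (z, w)) [::]) ->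
  exists u D, (forall t, agrees X t u -> derivation t D) /\ List.In (e, (z, w)) D.
  by move=> H; exists 0, [:: (e, (z, w))]; split; [move=> t _; split | left].
move: c x y; apply: eval_nested_ind.
- by move=> x; apply: ax => t; left; rewrite /= nfst_npair.
- by move=> x; apply: ax => t; right; left; rewrite /= nfst_npair.
- by move=> x; apply: ax => t; do 2 right; left; rewrite /= nfst_npair.
- by move=> x; apply: ax => t; do 3 right; left; rewrite /= nfst_npair.
- by move=> x; apply: ax => t; do 4 right; left; rewrite /= nfst_npair.
- move=> x Xx; exists x.+1, [:: (encode COracle, (x, 1))]; split; last by left.
  move=> t [l H]; split=> //; do 5 right; left.
  by rewrite /= nfst_npair H // (iffRL (chi1 _ _) Xx).
- move=> x Xx; exists x.+1, [:: (encode COracle, (x, 0))]; split; last by left.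
  move=> t [l H]; split=> //; do 5 right; left.
  by rewrite /= nfst_npair H // (iffRL (chi0 _ _) Xx).
- move=> f g x a b [u1 [D1 [H1 I1]]] [u2 [D2 [H2 I2]]].
  exists (u1 + u2), ((encode (CPair f g), (x, npair a b)) :: D1 ++ D2); split; last by left.
  move=> t A; split; last by apply: derivation_cat; [apply: H1|apply: H2]; apply: agW A; lia.
  do 6 right; left; rewrite /= !nfst_npair !nsnd_npair ?nfst_npair; split=> //.
  exists (encode f, (x, a)); split; first by apply/In_cat; left.
  exists (encode g, (x, b)); split; first by apply/In_cat; right.
  by [].
- move=> f g x z y [u1 [D1 [H1 I1]]] [u2 [D2 [H2 I2]]].
  exists (u1 + u2), ((encode (CComp f g), (x, y)) :: D1 ++ D2); split; last by left.
  move=> t A; split; last by apply: derivation_cat; [apply: H1|apply: H2]; apply: agW A; lia.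
  do 7 right; left; rewrite /= !nfst_npair !nsnd_npair ?nfst_npair; split=> //.
  exists (encode g, (x, z)); split; first by apply/In_cat; left.
  by do 2 split=> //; apply/In_cat; right.
- move=> f g x y [u1 [D1 [H1 I1]]].
  exists u1, ((encode (CPrim f g), (npair x 0, y)) :: D1); split; last by left.
  move=> t A; split; last exact: H1.
  by do 8 right; left; rewrite /= !nsnd_npair !nfst_npair.
- move=> f g x n z y [u1 [D1 [H1 I1]]] [u2 [D2 [H2 I2]]].
  exists (u1 + u2), ((encode (CPrim f g), (npair x n.+1, y)) :: D1 ++ D2); split; last by left.
  move=> t A; split; last by apply: derivation_cat; [apply: H1|apply: H2]; apply: agW A; lia.
  do 9 right; left; rewrite /= !nsnd_npair !nfst_npair; split=> //; split=> //.
  exists (encode (CPrim f g), (npair x n, z)); split; first by apply/In_cat; left.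
  by do 2 split=> //; apply/In_cat; right.
- move=> f x n [u0 [D0 [H0 I0]]] Hm.
  (* The finitely many computations below [n] are merged into one list; the sum of their uses bounds
     its use. *)
  have [u [D [HD ID]]] : exists u D, (forall t, agrees X t u -> derivation t D) /\
      forall m, m < n -> exists k, List.In (encode f, (npair x m, k.+1)) D.
    elim: n Hm {H0 I0} => [|n IH] Hm; first by exists 0, [::].
    have [m lt|u1 [D1 [H1 I1]]] := IH; first by apply: Hm; lia.
    have [k [u2 [D2 [H2 I2]]]] := Hm n (ltnSn n).
    exists (u1 + u2), (D1 ++ D2); split.
      by move=> t A; apply: derivation_cat; [apply: H1|apply: H2]; apply: agW A; lia.
    move=> m; rewrite ltnS leq_eqVlt => /orP[/eqP ->|/I1 [j J]].
      by exists k; apply/In_cat; right.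
    by exists j; apply/In_cat; left.
  exists (u0 + u), ((encode (CMu f), (x, n)) :: D0 ++ D); split; last by left.
  move=> t A; split; last by apply: derivation_cat; [apply: H0|apply: HD]; apply: agW A; lia.
  do 10 right; rewrite /= !nsnd_npair !nfst_npair; split=> //; split; first by apply/In_cat; left.
  move=> m /ID [k I]; exists (encode f, (npair x m, k.+1)); split=> //.
  by apply/In_cat; right.
Qed.

(** * Constraints on strings of levels *)

Definition extends (s t : seq nat) : Prop :=
  size s <= size t /\ forall x, x < size s -> nth 0 t x = nth 0 s x.

Lemma decidable_extends O : decidable_in O (fun z : seq nat * seq nat => extends z.1 z.2).
Proof. by rewrite /extends; deciding. Qed.

Lemma extends_cat s t : extends s (s ++ t).
Proof. by split=> [|x lt]; rewrite ?size_cat ?leq_addr // nth_cat lt. Qed.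

Lemma extendsE s t : extends s t -> t = s ++ drop (size s) t.
Proof.
move=> [le H]; rewrite -[LHS](cat_take_drop (size s)); congr cat.
have st : size (take (size s) t) = size s by rewrite size_takel.
by apply: (@eq_from_nth _ 0) => // x; rewrite st => lt; rewrite nth_take // H.
Qed.

Lemma extends_trans t s u : extends s t -> extends t u -> extends s u.
Proof. by move=> /extendsE -> /extendsE ->; rewrite -catA; apply: extends_cat. Qed.

(* Requirements are numbered: [(0, (m, _))] asks for at least [m] elements, and [(a.+1, (e, i))] asks that the
   functional [e] does not compute the [i]-th set. In the first case every value counts as an output. *)
Definition req_kind (r : nat) : nat := nfst r.
Definition req_arg (r : nat) : nat := nfst (nsnd r).
Definition req_set (r : nat) : nat := nsnd (nsnd r).

(** The bound [s] on codes of derivations makes the predicate decidable; in a constraint it is the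
    length of the string of levels. The sum of a bit string counts its elements. *)
Definition outputs (s : nat) (t : seq nat) (r n v : nat) : Prop :=
  (req_kind r = 0 /\ req_arg r <= foldr addn 0 t) \/
  (req_kind r <> 0 /\ exists m, m < s /\ derivation t (dec m) /\ List.In (req_arg r, (n, v)) (dec m)).

Definition nonempty_req : nat := enc (0, (1, 0)).

Lemma outputs_mono s s' t t' r n v : s <= s' -> extends t t' -> outputs s t r n v -> outputs s' t' r n v.
Proof.
move=> le ex [[k0 le']|[k0 [m [lt [D I]]]]]; [left; split=> // | right; split=> //].
  rewrite (extendsE ex) foldr_cat; apply: leq_trans le' _.
  move: (foldr addn 0 (drop _ _)) => z.
  by elim: (t) => //= a l; rewrite leq_add2l.
exists m; split; first exact: leq_trans lt le.
by split=> //; apply: derivation_mono D; case: ex => // ? H x lt'; rewrite H.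
Qed.

(* The constraint [(lo, (ex, (base, (r, (n, v)))))] on a string [s] of levels forbids [v] as an output at [n],
   in requirement [r], of bit strings extending [base] by elements whose level is at least [lo]
   (exactly [lo] if [ex] is nonzero). *)
Definition constraint : Type := nat * (nat * (seq nat * (nat * (nat * nat)))).

Notation c_lo c := (c.1) (only parsing).
Notation c_exact c := (c.2.1) (only parsing).
Notation c_base c := (c.2.2.1) (only parsing).

Definition allowed (c : constraint) (y : nat) : Prop := c_lo c <= y /\ (c_exact c = 0 \/ y = c_lo c).

Definition violates (s : seq nat) (c : constraint) (t : seq nat) : Prop :=
  extends (c_base c) t /\
  (forall x, x < size s -> size (c_base c) <= x -> 0 < nth 0 t x -> allowed c (nth 0 s x)) /\
  outputs (size s) t c.2.2.2.1 c.2.2.2.2.1 c.2.2.2.2.2.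

Definition good (G : seq constraint) (s : seq nat) : Prop :=
  forall c, List.In c G -> forall t, List.In t (strings 1 (size s)) -> ~ violates s c t.

(* Arbitrarily long good extensions of [p]: a nonempty Pi-0-1 class, of which no member is ever chosen. *)
Definition live (k : nat) (G : seq constraint) (p : seq nat) : Prop :=
  forall m, exists s, List.In s (strings k m) /\ good G (p ++ s).

Lemma decidable_outputs O :
  decidable_in O (fun z : (nat * seq nat) * (nat * (nat * nat)) => outputs z.1.1 z.1.2 z.2.1 z.2.2.1 z.2.2.2).
Proof.
rewrite /outputs /req_kind /req_arg; deciding; try by apply: (comp_comp comp_dec); comp.
by apply: (decidable_sub2 (P := derivation)); [apply: decidable_derivation | comp | apply: (comp_comp comp_dec); comp].
Qed.

Lemma decidable_good O : decidable_in O (fun z : seq constraint * seq nat => good z.1 z.2).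
Proof.
rewrite /good /violates; deciding; last by apply: comp_strings; comp.
- by apply: (decidable_sub2 (P := extends)); [apply: decidable_extends | comp | comp].
- by rewrite /allowed; deciding.
- by apply: (decidable_sub (f := fun z : seq constraint * seq nat * constraint * seq nat =>
    ((size z.1.1.2, z.2), (z.1.2.2.2.2.1, (z.1.2.2.2.2.2.1, z.1.2.2.2.2.2.2)))) (decidable_outputs O)); comp.
Qed.

(** A class that is not live dies at some finite length, where the finitely many strings can all be
    checked. *)
Lemma semi_not_live : semi empty_set (fun z : nat * (seq constraint * seq nat) => ~ live z.1 z.2.1 z.2.2).
Proof.
apply: (@semi_ext _ _ _ (fun z : nat * (seq constraint * seq nat) => exists m, forall s, List.In s (strings z.1 m) ->
   ~ good z.2.1 (z.2.2 ++ s))).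
  move=> [k [G p]] /=; split=> [[m H] /(_ m) [s [I g]] | H]; first exact: H I g.
  apply: NNPP => N; apply: H => m; apply: NNPP => N'; apply: N; exists m => s I g.
  by apply: N'; exists s.
apply: semi_ex; apply: semi_decidable; deciding; last by apply: comp_strings; comp.
by apply: (decidable_sub2 (P := good)); [apply: decidable_good | comp | comp].
Qed.

Lemma decidable_live : decidable_in halting_set (fun z : nat * (seq constraint * seq nat) => live z.1 z.2.1 z.2.2).
Proof.
apply: decidable_ext (decidable_not (decidable_halting semi_not_live)) => z.
by split=> [|L]; [apply: NNPP | apply].
Qed.

Lemma strings_cat k m m' s t :
  List.In s (strings k m) -> List.In t (strings k m') -> List.In (s ++ t) (strings k (m + m')).
Proof. by move=> /stringsP [<- As] /stringsP [<- At]; apply/stringsP; rewrite size_cat all_cat As At. Qed.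

Lemma strings_nseq k m a : a <= k -> List.In (nseq m a) (strings k m).
Proof. by move=> le; apply/stringsP; rewrite size_nseq; split=> //; apply/allP => x /nseqP [->]. Qed.

(** Padding with zeros adds no element, so that a violation persists when the string of levels is
    lengthened. *)
Lemma violates_cat s w c t : size t = size s ->
  violates s c t -> violates (s ++ w) c (t ++ nseq (size w) 0).
Proof.
move=> st [e [al o]]; split; first exact: extends_trans e (extends_cat _ _).
split; last by apply: outputs_mono o; rewrite ?size_cat ?leq_addr //; apply: extends_cat.
move=> x _ bx; rewrite !nth_cat st; case: (ltnP x (size s)) => lt; first exact: al.
by rewrite nth_nseq if_same.
Qed.

Lemma good_cat G s w : good G (s ++ w) -> good G s.
Proof.
move=> g c I t It v; apply: (g c I (t ++ nseq (size w) 0)).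
  by rewrite size_cat; apply: strings_cat It _; apply: strings_nseq.
by apply: violates_cat v; case/stringsP: It.
Qed.

Lemma good_sub G G' s : (forall c, List.In c G -> List.In c G') -> good G' s -> good G s.
Proof. by move=> H g c /H; apply: g. Qed.

Lemma live_good k G p : live k G p -> good G p.
Proof. by move=> /(_ 0) [s [/stringsP [/size0nil -> _]]]; rewrite cats0. Qed.

Lemma strings_take k m m' s : m <= m' -> List.In s (strings k m') ->
  List.In (take m s) (strings k m) /\ List.In (drop m s) (strings k (m' - m)).
Proof.
move=> le /stringsP [e]; rewrite -{1}(cat_take_drop m s) all_cat => /andP[a b].
by split; apply/stringsP; split=> //; rewrite ?size_drop ?e // size_takel // e.
Qed.

(** Compactness: if each of the finitely many blocks of length [m] led to a dead class, a single
    length [M] would kill all of them, and [p] would be dead at length [m + M]. *)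
Lemma live_cat k G p m : live k G p -> exists s, List.In s (strings k m) /\ live k G (p ++ s).
Proof.
move=> L; apply: NNPP => N.
have [M HM] : exists M, forall s, List.In s (strings k m) ->
    forall w, List.In w (strings k M) -> ~ good G (p ++ s ++ w).
  have : forall s, List.In s (strings k m) -> ~ live k G (p ++ s) by move=> s I H; apply: N; exists s.
  elim: (strings k m) => [|s l IH] H; first by exists 0.
  have [|M1 H1] := IH; first by move=> s' I; apply: H; right.
  have [M2 H2] : exists M2, forall w, List.In w (strings k M2) -> ~ good G (p ++ s ++ w).
    apply: NNPP => N2; apply: (H s); first by left.
    move=> M2; apply: NNPP => N3; apply: N2; exists M2 => w I g; apply: N3; exists w.
    by rewrite -catA.
  have short M M' s' : M <= M' -> (forall w, List.In w (strings k M) -> ~ good G (p ++ s' ++ w)) ->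
      forall w, List.In w (strings k M') -> ~ good G (p ++ s' ++ w).
    move=> le K w I g; have [I1 I2] := strings_take le I; apply: (K _ I1).
    by apply: (@good_cat _ _ (drop M w)); rewrite -!catA cat_take_drop.
  exists (M1 + M2) => s' [<-|I]; first by apply: short H2; lia.
  by apply: short (H1 _ I); lia.
have [s [I g]] := L (m + M).
have [I1 I2] := strings_take (leq_addr M m) I.
by apply: (HM _ I1 _ _ (_ : good G (p ++ take m s ++ drop m s))); rewrite ?cat_take_drop //; move: I2; rewrite addKn.
Qed.

Definition levels_below (k : nat) (G : seq constraint) : Prop :=
  forall c, List.In c G -> c_lo c <= k /\ (c_exact c = 0 \/ c_lo c < k).

Lemma nth_min k s x : nth 0 (map (minn k) s) x = minn k (nth 0 s x).
Proof.
case: (ltnP x (size s)) => lt; first by rewrite (nth_map 0).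
by rewrite !nth_default ?size_map // minn0.
Qed.

(** Cutting levels down to [k] changes no comparison with a bound that is at most [k] and no
    equality with an exact level below [k]. *)
Lemma good_min k G s : levels_below k G -> good G s <-> good G (map (minn k) s).
Proof.
move=> wf.
have al c y : List.In c G -> allowed c y <-> allowed c (minn k y).
  by move=> /wf [le ex]; rewrite /allowed; split=> -[l [e|e]]; split; lia.
have vi c t : List.In c G -> violates s c t <-> violates (map (minn k) s) c t.
  move=> I; rewrite /violates size_map.
  split=> -[e [a o]]; split=> //; split=> // x lt bx tx; have := a x lt bx tx; rewrite nth_min.
    exact: (iffLR (al _ _ I)).
  exact: (iffRL (al _ _ I)).
by split=> g c I t; have := g c I t; rewrite size_map => H It /(vi _ _ I); apply: H.
Qed.

(* Given the partial information on [(C0 n0, C1 n1)] that enumerating the wrong pairs provides, one of the two sets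
   can be computed: [C0] if every [n0] has an [n1] at which both [(C0 n0, _)] are enumerated, and otherwise
   [C1], with [n0] fixed to a counterexample. *)
Lemma computable_from_pairs (Q : nat -> nat -> nat -> nat -> Prop) (C0 C1 : nat -> Prop) :
  semi empty_set (fun z : nat * (nat * (nat * nat)) => Q z.1 z.2.1 z.2.2.1 z.2.2.2) ->
  (forall n0 n1, Q n0 n1 (chi C0 n0) (chi C1 n1)) ->
  (forall n0 n1, ~ Q n0 n1 (1 - chi C0 n0) (1 - chi C1 n1)) ->
  turing_le C0 empty_set \/ turing_le C1 empty_set.
Proof.
move=> sQ Q1 Q0.
have flip (P : nat -> Prop) n a : a <= 1 -> a <> chi P n -> a = 1 - chi P n.
  by have := chi_le1 P n; lia.
case: (classic (forall n0, exists n1, Q n0 n1 (chi C0 n0) (1 - chi C1 n1))) => H.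
  left; apply/turing_le_computable.
  (* If [a] were wrong, one of the two enumerated pairs would consist of two wrong values, contrary
     to [Q0]. *)
  apply: (semi_graph (Q := fun n a => a <= 1 /\ exists n1, Q n n1 a 0 /\ Q n n1 a 1)).
  - apply: semi_and; first by apply: semi_decidable; deciding.
    apply: semi_ex; apply: semi_and.
      by apply: (semi_sub (f := fun z : nat * nat * nat => (z.1.1, (z.2, (z.1.2, 0)))) sQ); comp.
    by apply: (semi_sub (f := fun z : nat * nat * nat => (z.1.1, (z.2, (z.1.2, 1)))) sQ); comp.
  - move=> n; split; first exact: chi_le1.
    have [n1 Qn] := H n; exists n1; have := Q1 n n1; move: Qn; have := chi_le1 C1 n1.
    by case: (chi C1 n1) => [|[|]] //.
  move=> n a [le [n1 [q0 q1]]]; apply: NNPP => /(flip _ _ _ le) E; apply: (Q0 n n1); rewrite -E.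
  by have := chi_le1 C1 n1; case: (chi C1 n1) => [|[|]] //.
right; apply/turing_le_computable.
have [n0 Hn] : exists n0, forall n1, ~ Q n0 n1 (chi C0 n0) (1 - chi C1 n1).
  apply: NNPP => N; apply: H => n0; apply: NNPP => N'; apply: N; exists n0 => n1 q; apply: N'; by exists n1.
apply: (semi_graph (Q := fun n a => a <= 1 /\ Q n0 n (chi C0 n0) a)).
- apply: semi_and; first by apply: semi_decidable; deciding.
  by apply: (semi_sub (f := fun z : nat * nat => (n0, (z.1, (chi C0 n0, z.2)))) sQ); comp.
- by move=> n; split; [apply: chi_le1|].
- by move=> n a [le q]; apply: NNPP => /(flip _ _ _ le) E; apply: (Hn n); rewrite -E.
Qed.

(** * The construction *)

(* A frame: the level [k] of its reservoir (the elements of level at least [k]), the red requirement [r] it works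
   on, its blue string [b], the blue requirement [j] it works on, and the constraints in force. *)
Definition frame : Type := nat * (nat * (seq nat * (nat * seq constraint))).
Notation lev f := (f.1) (only parsing).
Notation rq f := (f.2.1) (only parsing).
Notation bs f := (f.2.2.1) (only parsing).
Notation bj f := (f.2.2.2.1) (only parsing).
Notation cs f := (f.2.2.2.2) (only parsing).

(* The levels [p], the red string [d], the active frame and the suspended ones, each with the pair [(n, v)]
   of the blue constraint it takes over when it is resumed. *)
Definition state : Type := seq nat * (seq nat * (frame * seq (frame * (nat * nat)))).
Notation pre S := (S.1) (only parsing).
Notation red S := (S.2.1) (only parsing).
Notation top S := (S.2.2.1) (only parsing).
Notation stk S := (S.2.2.2) (only parsing).

Definition pad (b : seq nat) (m : nat) : seq nat := b ++ nseq (m - size b) 0.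

Lemma comp_pad {O T} {cT : coded T} (b : T -> seq nat) (m : T -> nat) :
  computable O b -> computable O m -> computable O (fun x => pad (b x) (m x)).
Proof. by move=> cb cm; rewrite /pad; comp. Qed.

Lemma size_pad b m : size b <= m -> size (pad b m) = m.
Proof. by move=> le; rewrite size_cat size_nseq subnKC. Qed.

Lemma nth_pad b m x : nth 0 (pad b m) x = nth 0 b x.
Proof. by rewrite nth_cat nth_nseq if_same; case: ltnP => // le; rewrite nth_default. Qed.

Lemma pad_bits b m n : List.In b (strings 1 m) -> List.In (pad b n) (strings 1 (m + (n - m))).
Proof. by move=> I; apply: strings_cat (I) _; case/stringsP: I => -> _; apply: strings_nseq. Qed.

(** Forbids even one new element of level at least [k]: if the class stays live under this
    constraint, the reservoir of level [k] may be finite. *)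
Definition exhausted (k : nat) (p : seq nat) : constraint :=
  (k, (0, (nseq (size p) 0, (nonempty_req, (0, 0))))).

Section Construction.
Variables (A : nat -> Prop) (C : nat -> nat -> Prop).

Definition value (r n : nat) : nat := chi (C (req_set r)) n.

(** When the active reservoir may be finite, the frame suspended below it is resumed. New elements
    then stay off the upper level, so that the exact blue constraint of the split becomes a
    constraint on the whole lower reservoir, which meets the blue requirement. *)
Definition pops (S S' : state) : Prop :=
  exists (e : frame * (nat * nat)) rest,
    stk S = e :: rest /\
    live (lev (top S)) (exhausted (lev (top S)) (pre S) :: cs (top S)) (pre S) /\
    S' = (map (minn (lev e.1)) (pre S), (red S, ((lev e.1, (rq e.1, (pad (bs e.1) (size (pre S)), ((bj e.1).+1,
      (lev e.1, (0, (pad (bs e.1) (size (pre S)), (bj e.1, e.2)))) :: cs e.1)))), rest))).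

(** The length [l] certifies that the reservoir cannot be exhausted: every good [p'] of this size
    contains a new element of it. *)
Definition enlarges (S : state) (p' : seq nat) : Prop :=
  extends (pre S) p' /\
  exists l, size (pre S) + l <= size p' /\
    forall s, List.In s (strings (lev (top S)) l) ->
      ~ good (exhausted (lev (top S)) (pre S) :: cs (top S)) (pre S ++ s).

(** A partition of the reservoir of level [k] is coded by levels: its red part is raised to [k.+1],
    its blue part keeps exactly the level [k]. *)
Definition split_constraints (S : state) (n0 n1 v0 v1 : nat) : seq constraint :=
  ((lev (top S)).+1, (0, (red S, (rq (top S), (n0, v0))))) ::
  (lev (top S), (1, (bs (top S), (bj (top S), (n1, v1))))) :: cs (top S).

Definition forces (S S' : state) : Prop :=
  exists p' n0 n1,
    let v0 := value (rq (top S)) n0 in let v1 := value (bj (top S)) n1 in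
    enlarges S p' /\ List.In p' (strings (lev (top S)).+1 (size p')) /\
    live (lev (top S)).+1 (split_constraints S n0 n1 v0 v1) p' /\
    S' = (p', (pad (red S) (size p'),
      (((lev (top S)).+1, ((rq (top S)).+1, (nseq (size p') 0, (0,
          ((lev (top S)).+1, (0, (red S, (rq (top S), (n0, v0))))) ::
          (lev (top S), (1, (bs (top S), (bj (top S), (n1, v1))))) :: cs (top S))))),
       (top S, (n1, v1)) :: stk S))).

(** A finite extension inside the reservoir and [B] that meets [r] outright, since [1 - value r n]
    is the wrong value. *)
Definition grows (B : nat -> Prop) (k : nat) (p' b t : seq nat) (r : nat) : Prop :=
  extends b t /\ List.In t (strings 1 (size p')) /\
  (forall x, x < size p' -> size b <= x -> 0 < nth 0 t x -> k <= nth 0 p' x /\ B x) /\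
  exists n s, outputs s t r n (1 - value r n).

Definition grows_red (S S' : state) : Prop :=
  exists p' t, enlarges S p' /\ List.In p' (strings (lev (top S)) (size p')) /\
    live (lev (top S)) (cs (top S)) p' /\ grows A (lev (top S)) p' (red S) t (rq (top S)) /\
    S' = (p', (t, ((lev (top S), ((rq (top S)).+1, (nseq (size p') 0, (0, cs (top S))))), stk S))).

Definition grows_blue (S S' : state) : Prop :=
  exists p' t, enlarges S p' /\ List.In p' (strings (lev (top S)) (size p')) /\
    live (lev (top S)) (cs (top S)) p' /\ grows (complement A) (lev (top S)) p' (bs (top S)) t (bj (top S)) /\
    S' = (p', (pad (red S) (size p'), ((lev (top S), (rq (top S), (t, ((bj (top S)).+1, cs (top S))))), stk S))).

Definition step (S S' : state) : Prop :=
  pops S S' \/ forces S S' \/ grows_red S S' \/ grows_blue S S'.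

(** * The step relation is semidecidable in the halting set *)

Section StepSemidecidable.
Hypotheses (hA : decidable_in halting_set A)
  (hC : computable halting_set (fun z : nat * nat => chi (C z.1) z.2)).

Lemma comp_value {T} {cT : coded T} (r n : T -> nat) :
  computable halting_set r -> computable halting_set n -> computable halting_set (fun x => value (r x) (n x)).
Proof.
move=> cr cn; apply: (comp_app2 (h := fun i n => chi (C i) n)) => //.
by rewrite /req_set; comp.
Qed.

Lemma decidable_liveC {T} {cT : coded T} (k : T -> nat) G p :
  computable halting_set k -> computable halting_set G -> computable halting_set p ->
  decidable_in halting_set (fun x => live (k x) (G x) (p x)).
Proof. exact: (decidable_sub3 (P := live) decidable_live). Qed.

Ltac semi_step :=
  match goal with
  | |- semi _ (fun x => ex _) => apply: semi_ex
  | |- semi _ (fun x => _ /\ _) => apply: semi_and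
  | |- semi _ (fun x => _ \/ _) => apply: semi_or
  end.

Lemma semi_enlarges {T} {cT : coded T} (S : T -> state) (p : T -> seq nat) :
  computable halting_set S -> computable halting_set p -> semi halting_set (fun x => enlarges (S x) (p x)).
Proof.
move=> cS cp; rewrite /enlarges; repeat (cbv beta; semi_step); apply: semi_decidable.
- by apply: (decidable_sub2 (P := extends)); [apply: decidable_extends | comp | comp].
- by deciding.
- deciding; last by apply: comp_strings; comp.
  by apply: (decidable_sub2 (P := good)); [apply: decidable_good | rewrite /exhausted; comp | comp].
Qed.

Lemma semi_grows B {T} {cT : coded T} (k r : T -> nat) (p b t : T -> seq nat) :
  decidable_in halting_set B ->
  computable halting_set k -> computable halting_set r -> computable halting_set p ->
  computable halting_set b -> computable halting_set t ->
  semi halting_set (fun x => grows B (k x) (p x) (b x) (t x) (r x)).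
Proof.
move=> dB ck cr cp cb ct; rewrite /grows; repeat (cbv beta; semi_step); apply: semi_decidable.
- by apply: (decidable_sub2 (P := extends)); [apply: decidable_extends | comp | comp].
- by deciding; apply: comp_strings; comp.
- by deciding; apply: (decidable_sub (P := B)) => //; comp.
- apply: (decidable_sub (f := fun z : T * nat * nat => ((z.2, t z.1.1), (r z.1.1, (z.1.2, 1 - value (r z.1.1) z.1.2))))
    (decidable_outputs _)); comp; apply: comp_value; comp.
Qed.

Lemma semi_step_relation : semi halting_set (fun z : state * state => step z.1 z.2).
Proof.
have dA : decidable_in halting_set (complement A) by apply: decidable_not.
rewrite /step /pops /forces /grows_red /grows_blue /split_constraints /=.
repeat (cbv beta; semi_step);
  try (by apply: semi_enlarges; comp); try (by apply: semi_grows; comp); apply: semi_decidable;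
  rewrite /exhausted; deciding; try (by apply: comp_strings; comp);
  try (by apply: comp_pad; comp); try (by apply: comp_value; comp);
  try (apply: decidable_liveC; rewrite /exhausted; comp);
  try (by apply: comp_pad; comp); try (by apply: comp_value; comp).
by apply: (comp_minn (f := fun y => y.1.1.2.1.1)); comp.
Qed.
End StepSemidecidable.
End Construction.

(** * Invariants of the construction *)

Section Invariant.
Variables (A : nat -> Prop) (C : nat -> nat -> Prop).
Local Notation value := (value C).
Local Notation step := (step A C).

(* [b] extends [base] by elements of level at least [l], so that a forbidden output of [b] would violate a
   constraint with this base. *)
Definition fits (l : nat) (base b p : seq nat) : Prop :=
  extends base b /\ forall x, size base <= x -> 0 < nth 0 b x -> l <= nth 0 p x.

(** A requirement is met in one of two ways: by a wrong output already present, or by a constraint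
    in force that forbids the right one. *)
Definition red_credit (f : frame) (p d : seq nat) (r : nat) : Prop :=
  (exists n s, outputs s d r n (1 - value r n)) \/
  (exists n l base, List.In (l, (0, (base, (r, (n, value r n))))) (cs f) /\ fits l base d p).

Definition blue_credit (f : frame) (p : seq nat) (j : nat) : Prop :=
  (exists n s, outputs s (bs f) j n (1 - value j n)) \/
  (exists n base, List.In (lev f, (0, (base, (j, (n, value j n))))) (cs f) /\ fits (lev f) base (bs f) p).

Definition frame_inv (p d : seq nat) (f : frame) : Prop :=
  levels_below (lev f) (cs f) /\ size (bs f) <= size p /\ List.In (bs f) (strings 1 (size (bs f))) /\
  (forall x, 0 < nth 0 (bs f) x -> ~ A x) /\
  (forall r, r < rq f -> red_credit f p d r) /\ (forall j, j < bj f -> blue_credit f p j).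

(** Levels go down by one to 0 and red requirements decrease. Each frame inherits the constraints of
    the one suspended below it, with the exact blue constraint that [pops] will convert. *)
Fixpoint chain (f : frame) (es : seq (frame * (nat * nat))) : Prop :=
  if es is e :: es' then
    lev f = (lev e.1).+1 /\ rq e.1 < rq f /\
    (forall c, List.In c ((lev e.1, (1, (bs e.1, (bj e.1, e.2)))) :: cs e.1) -> List.In c (cs f)) /\
    e.2.2 = value (bj e.1) e.2.1 /\ chain e.1 es'
  else lev f = 0.

Definition inv (S : state) : Prop :=
  List.In (pre S) (strings (lev (top S)) (size (pre S))) /\ live (lev (top S)) (cs (top S)) (pre S) /\
  size (red S) = size (pre S) /\ size (bs (top S)) = size (pre S) /\
  List.In (red S) (strings 1 (size (red S))) /\ (forall x, 0 < nth 0 (red S) x -> A x) /\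
  chain (top S) (stk S) /\ frame_inv (pre S) (red S) (top S) /\
  forall e, List.In e (stk S) -> frame_inv (pre S) (red S) e.1.

Lemma fits_extends l base b b' p p' : fits l base b p -> extends b b' -> extends p p' -> size b <= size p ->
  (forall x, size b <= x -> 0 < nth 0 b' x -> l <= nth 0 p' x) -> fits l base b' p'.
Proof.
move=> [e H] [lb eb] [lp ep] le new; split; first exact: extends_trans e (conj lb eb).
move=> x bx b'x; case: (ltnP x (size b)) => lt; last exact: new.
by rewrite ep; [apply: H; rewrite -?eb | lia].
Qed.

Lemma fits_min l base b p k : l <= k -> fits l base b p -> fits l base b (map (minn k) p).
Proof. by move=> le [e H]; split=> // x bx /(H _ bx); rewrite nth_min; lia. Qed.

Lemma nth_gt0 (b : seq nat) x : 0 < nth 0 b x -> x < size b.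
Proof. by case: (ltnP x (size b)) => // le; rewrite nth_default. Qed.

Lemma strings_mkseq k (f : nat -> nat) m : (forall x, x < m -> f x <= k) -> List.In (mkseq f m) (strings k m).
Proof.
move=> H; apply/stringsP; rewrite size_mkseq; split=> //; apply/(all_nthP 0) => x.
by rewrite size_mkseq => lt; rewrite nth_mkseq //; apply: H.
Qed.

Lemma nth_le_sum (t : seq nat) x : nth 0 t x <= foldr addn 0 t.
Proof. by elim: t x => [|a t IH] [|x] //=; [apply: leq_addr | apply: leq_trans (IH x) (leq_addl _ _)]. Qed.

Lemma good_exhausted k p G s x : good (exhausted k p :: G) s -> size p <= x -> x < size s -> nth 0 s x < k.
Proof.
move=> g px xs; rewrite ltnNge; apply/negP => le.
(* The set with [x] as its only element violates the constraint. *)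
apply: (g (exhausted k p) _ (mkseq (fun y => (y == x) : nat) (size s))); first by left.
  by apply: strings_mkseq => y _; case: eqP.
have nt y : y < size s -> nth 0 (mkseq (fun y => (y == x) : nat) (size s)) y = (y == x) by apply: nth_mkseq.
split; last split.
- split=> /=; rewrite size_nseq ?size_mkseq; first lia.
  by move=> y ly; rewrite nth_nseq ly nt; [case: eqP => //; lia | lia].
- move=> y ys _; rewrite nt // /allowed; case: eqP => // -> _; split=> //; by left.
- left; rewrite /req_kind /req_arg /nonempty_req /= !nsnd_npair !nfst_npair; split=> //.
  by apply: leq_trans (nth_le_sum _ x); rewrite nt // eqxx.
Qed.

Lemma not_good_exhausted k p G s : good G s -> ~ good (exhausted k p :: G) s ->
  exists x, size p <= x /\ x < size s /\ k <= nth 0 s x.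
Proof.
move=> g ng; apply: NNPP => N; apply: ng => c [<-|I]; last exact: g.
move=> t It [[/= lb eb] [al [[_]|[]]]]; last by rewrite /req_kind /= nfst_npair.
rewrite /req_arg /= nsnd_npair nfst_npair => sm.
have [x tx] : exists x, 0 < nth 0 t x.
  apply: NNPP => N0; have : all (fun y => y == 0) t.
    apply/(all_nthP 0) => i _; apply/eqP.
    by case E: (nth 0 t i) => [|m] //; case: (N0); exists i; rewrite E.
  by elim: (t) sm => //= a l IH sm /andP[/eqP a0 /IH]; apply; move: sm; rewrite a0.
have xs : x < size s by case/stringsP: It => <- _; apply: nth_gt0.
have px : size p <= x.
  rewrite leqNgt; apply/negP => lt; move: (eb x); rewrite size_nseq nth_nseq lt => /(_ isT).
  by move=> E; rewrite E in tx.
apply: N; exists x; split=> //; split=> //.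
by have := al x xs; rewrite /= size_nseq => /(_ px tx) [].
Qed.

Lemma red_credit_sub f f' p d r : (forall c, List.In c (cs f) -> List.In c (cs f')) ->
  red_credit f p d r -> red_credit f' p d r.
Proof. by move=> s [H|[n [l [base [/s I H]]]]]; [left | right; exists n, l, base]. Qed.

Lemma red_credit_extends f p p' d d' r : levels_below (lev f) (cs f) ->
  extends p p' -> extends d d' -> size d <= size p ->
  (forall x, size d <= x -> 0 < nth 0 d' x -> lev f <= nth 0 p' x) ->
  red_credit f p d r -> red_credit f p' d' r.
Proof.
move=> wf ep ed le new [[n [s o]]|[n [l [base [I F]]]]]; [left | right].
  by exists n, s; apply: outputs_mono o.
exists n, l, base; split=> //; apply: fits_extends F ed ep le _ => x dx d'x.
by have [/= ll _] := wf _ I; apply: leq_trans ll (new _ dx d'x).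
Qed.

Lemma blue_credit_extends f f' p p' j : lev f' = lev f ->
  (forall c, List.In c (cs f) -> List.In c (cs f')) ->
  extends p p' -> extends (bs f) (bs f') -> size (bs f) <= size p ->
  (forall x, size (bs f) <= x -> 0 < nth 0 (bs f') x -> lev f <= nth 0 p' x) ->
  blue_credit f p j -> blue_credit f' p' j.
Proof.
move=> lf s ep ed le new [[n [m o]]|[n [base [I F]]]]; [left | right].
  by exists n, m; apply: outputs_mono o.
by rewrite lf; exists n, base; split; [exact: s | exact: fits_extends F ed ep le new].
Qed.

Lemma frame_inv_extends p p' d d' f : extends p p' -> extends d d' -> size d <= size p ->
  (forall x, size d <= x -> 0 < nth 0 d' x -> lev f <= nth 0 p' x) ->
  frame_inv p d f -> frame_inv p' d' f.
Proof.
move=> ep ed le new [wf [sb [bb [bA [rc bc]]]]]; split=> //; split; first by case: ep => ? _; lia.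
split=> //; split=> //; split=> [r /rc|j /bc]; first exact: red_credit_extends.
apply: blue_credit_extends => // x bx bx'; by have := nth_gt0 bx'; lia.
Qed.

Lemma red_credit_min f p d r k : levels_below (lev f) (cs f) -> lev f <= k ->
  red_credit f p d r -> red_credit f (map (minn k) p) d r.
Proof.
move=> wf le [H|[n [l [base [I F]]]]]; [by left | right; exists n, l, base; split=> //].
by apply: fits_min F; have [/= ll _] := wf _ I; apply: leq_trans ll le.
Qed.

Lemma blue_credit_min f p j k : lev f <= k -> blue_credit f p j -> blue_credit f (map (minn k) p) j.
Proof. by move=> le [H|[n [base [I F]]]]; [left | right; exists n, base; split=> //; apply: fits_min F]. Qed.

Lemma frame_inv_min p d f k : lev f <= k -> frame_inv p d f -> frame_inv (map (minn k) p) d f.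
Proof.
move=> le [wf [sb [bb [bA [rc bc]]]]]; do 4 (split; rewrite ?size_map //).
by split=> [r /rc|j /bc]; [apply: red_credit_min | apply: blue_credit_min].
Qed.

Lemma chain_top f f' es : lev f' = lev f -> rq f <= rq f' ->
  (forall c, List.In c (cs f) -> List.In c (cs f')) -> chain f es -> chain f' es.
Proof.
case: es => [|e es] /= lf le s; first by rewrite lf.
move=> [l [lt [H [v K]]]]; rewrite lf; split=> //; split; first exact: leq_trans lt le.
by split=> // c /H /s.
Qed.

Lemma chain_below f es : chain f es -> forall e, List.In e es ->
  lev e.1 < lev f /\ rq e.1 < rq f /\ forall c, List.In c (cs e.1) -> List.In c (cs f).
Proof.
elim: es f => //= e es IH f [lf [lt [s [_ K]]]] e' [<-|I].
  by rewrite lf; split=> //; split=> // c cI; apply: s; right.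
have [l1 [l2 l3]] := IH _ K _ I; split; first lia; split; first lia.
by move=> c /l3 cI; apply: s; right.
Qed.

Lemma pops_inv S S' : inv S -> pops S S' -> inv S'.
Proof.
case: S => p [d [[k [r [b [j G]]]] es]] [/= Hp [L [sd [sb [bd [dA [ch [fi fis]]]]]]]].
move=> [[[k0 [r0 [b0 [j0 G0]]]] [n v]] [rest /= [Ees [Lx ->]]]]; subst es.
move: ch => /= [lk [lr [sub [vE ch]]]]; subst k.
have [/= wf0 [sb0 [bb0 [bA0 [rc0 bc0]]]]] : frame_inv p d (k0, (r0, (b0, (j0, G0)))).
  by apply: (fis (_, _)); left.
have nb x : nth 0 (pad b0 (size p)) x = nth 0 b0 x by apply: nth_pad.
rewrite /inv /= !size_map size_pad //;
  split; [|split; [|split; [|split; [|split; [|split; [|split; [|split]]]]]]] => //.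
- apply/stringsP; rewrite size_map; split=> //; rewrite all_map; apply/allP => x _ /=; lia.
(* The same [s] witnesses that the resumed class is live: exhaustion keeps its levels at most [k0],
   so that truncation only alters [p]. *)
- move=> m; have [s [Is gs]] := Lx m.
  have lows x : size p <= x -> x < size (p ++ s) -> nth 0 (p ++ s) x <= k0.
    by move=> px xs; rewrite -ltnS; apply: good_exhausted gs px xs.
  have low_s i : i < size s -> nth 0 s i <= k0.
    move=> lt; have := lows (size p + i); rewrite size_cat ltn_add2l leq_addr.
    have -> : nth 0 (p ++ s) (size p + i) = nth 0 s i by rewrite nth_cat ltnNge leq_addr addKn.
    exact.
  have Es : map (minn k0) (p ++ s) = map (minn k0) p ++ s.
    rewrite map_cat; congr cat; rewrite -[RHS]map_id; apply/eq_in_map => x /(nthP 0) [i lt <-].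
    by apply/minn_idPr; apply: low_s.
  have sk : all (fun a => a <= k0) s.
    apply/(all_nthP 0) => i lt.
    exact: low_s.
  exists s; split; first by apply/stringsP; case/stringsP: Is => <-.
  rewrite -Es => c [<-|I].
    (* New elements have level at least [k0] by the new constraint and at most [k0] by exhaustion: a
       violation of it also violates the exact constraint of the split. *)
    move=> t It; rewrite /violates /= size_map => -[e [al o]].
    rewrite size_map in It.
    apply: (gs (k0, (1, (b0, (j0, (n, v))))) _ t) => //; first by right; apply: sub; left.
    rewrite /violates /=; split; first by apply: extends_trans e; apply: extends_cat.
    split=> // x xs bx tx.
    have px : size p <= x.
      rewrite leqNgt; apply/negP => lt; case: e => _ /(_ x); rewrite size_pad // nb => /(_ lt) E.
      by rewrite E nth_default in tx.
    have := al x xs; rewrite size_pad // nth_min => /(_ px tx) [/= ge _].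
    by have := lows x px xs; split=> /=; [|right]; lia.
  have := iffLR (good_min (p ++ s) wf0); apply=> //.
  by move=> c' I'; apply: gs; right; apply: sub; right.
- by apply: (chain_top (f := (k0, (r0, (b0, (j0, G0)))))) ch => //= c I; right.
- have fi0 : frame_inv p d (k0, (r0, (b0, (j0, G0)))) by apply: (fis (_, _)); left.
  have [_ [_ [_ [_ [rcm bcm]]]]] := frame_inv_min (k := k0) (leqnn k0 : lev (k0, (r0, (b0, (j0, G0)))) <= k0) fi0.
  split; first by move=> c [<-|/wf0] //=; split=> //; left.
  split; first by rewrite /= size_map size_pad.
  split; first by rewrite /= size_pad //; have := pad_bits (size p) bb0; rewrite subnKC.
  split; first by move=> x; rewrite /= nb; apply: bA0.
  split=> [r' /= /rcm|j' /=]; first by apply: red_credit_sub => c; right.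
  rewrite ltnS leq_eqVlt => /orP[/eqP ->|/bcm].
    right; exists n, (pad b0 (size p)); split; first by left; rewrite vE.
    split=> //= x; rewrite size_pad // nb => px b0x; by have := nth_gt0 b0x; lia.
  apply: blue_credit_extends => //=; [by move=> c; right | exact: extends_cat | by rewrite size_map |].
  by move=> x bx; rewrite nb => /nth_gt0; lia.
- move=> e I; have [lt _] := chain_below ch I; apply: frame_inv_min; first by apply: ltnW.
  by apply: fis; right.
Qed.

Lemma extends_pad b m : extends b (pad b m).
Proof. exact: extends_cat. Qed.

Lemma pad_new b m x : size b <= x -> 0 < nth 0 (pad b m) x -> False.
Proof. by rewrite nth_pad => le /nth_gt0; rewrite ltnNge le. Qed.

Lemma bits_pad b m : size b <= m -> List.In b (strings 1 (size b)) -> List.In (pad b m) (strings 1 (size (pad b m))).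
Proof. by move=> le I; rewrite size_pad //; have := pad_bits m I; rewrite subnKC. Qed.

(** New red elements have at least the active level, hence lie in the reservoir of every suspended
    frame. *)
Lemma frames_inv S p' d' : inv S -> extends (pre S) p' -> extends (red S) d' ->
  (forall x, size (red S) <= x -> 0 < nth 0 d' x -> lev (top S) <= nth 0 p' x) ->
  frame_inv p' d' (top S) /\ forall e, List.In e (stk S) -> frame_inv p' d' e.1.
Proof.
move=> [Hp [L [sd [sb [bd [dA [ch [fi fis]]]]]]]] ep ed new.
split=> [|e I]; first by apply: frame_inv_extends ep ed _ new fi; rewrite sd.
have [lt _] := chain_below ch I.
apply: frame_inv_extends ep ed _ _ (fis _ I); first by rewrite sd.
by move=> x dx d'x; apply: leq_trans (ltnW lt) (new _ dx d'x).
Qed.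

Lemma forces_inv S S' : inv S -> forces C S S' -> inv S'.
Proof.
move=> iS [p' [n0 [n1 [[ep [l [sl _]]] [Ip' [L' ->]]]]]].
have le : size (pre S) <= size p' by lia.
have [fi' fis'] := frames_inv iS ep (extends_pad (red S) (size p')) (fun x dx d'x => False_ind _ (pad_new dx d'x)).
case: iS => [Hp [L [sd [sb [bd [dA [ch [fi fis]]]]]]]].
rewrite /inv /= size_pad ?sd // size_nseq.
split=> //; split=> //; split=> //; split=> //; split.
  by have := bits_pad (m := size p') _ bd; rewrite size_pad ?sd //; apply.
split; first by move=> x; rewrite nth_pad; apply: dA.
split; first by split=> //; split=> //; split=> // c [<-|I]; right; [left|right].
split; last by move=> e [<-|/fis'].
case: fi' => [wf [_ [_ [_ [rc _]]]]].
split; first by move=> c [<-|[<-|/wf [cl ce]]] /=; split=> //; [left|right| |]; lia.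
split; first by rewrite /= size_nseq.
split; first by rewrite /= size_nseq; apply: strings_nseq.
split; first by move=> x; rewrite /= nth_nseq if_same.
split=> // r' /=; rewrite ltnS leq_eqVlt => /orP[/eqP ->|/rc].
  right; exists n0, (lev (top S)).+1, (red S); split; first by left.
  by split; [apply: extends_pad | move=> x dx /(pad_new dx)].
by apply: red_credit_sub => c I; right; right.
Qed.

Lemma grows_red_inv S S' : inv S -> grows_red A C S S' -> inv S'.
Proof.
move=> iS [p' [t [[ep [l [sl _]]] [Ip' [L' [[et [It [al [n [s o]]]]] ->]]]]]].
have le : size (pre S) <= size p' by lia.
have st : size t = size p' by case/stringsP: It.
have new x : size (red S) <= x -> 0 < nth 0 t x -> lev (top S) <= nth 0 p' x /\ A x.
  by move=> dx tx; apply: al => //; have := nth_gt0 tx; rewrite st.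
have [fi' fis'] := frames_inv iS ep et (fun x dx d'x => (new x dx d'x).1).
case: iS => [Hp [L [sd [sb [bd [dA [ch [fi fis]]]]]]]].
rewrite /inv /= st size_nseq; do 5 (split=> //).
split.
  move=> x tx; case: (ltnP x (size (red S))) => dx; last by case: (new x dx tx).
  by apply: dA; case: et => _ /(_ _ dx) <-.
split; first exact: (chain_top (f := top S)) ch.
split=> //; case: fi' => [wf [_ [_ [_ [rc _]]]]].
split=> //; split; first by rewrite /= size_nseq.
split; first by rewrite /= size_nseq; apply: strings_nseq.
split; first by move=> x; rewrite /= nth_nseq if_same.
split=> // r' /=; rewrite ltnS leq_eqVlt => /orP[/eqP ->|/rc] //.
by left; exists n, s.
Qed.

Lemma grows_blue_inv S S' : inv S -> grows_blue A C S S' -> inv S'.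
Proof.
move=> iS [p' [t [[ep [l [sl _]]] [Ip' [L' [[et [It [al [n [s o]]]]] ->]]]]]].
have le : size (pre S) <= size p' by lia.
have st : size t = size p' by case/stringsP: It.
have new x : size (bs (top S)) <= x -> 0 < nth 0 t x -> lev (top S) <= nth 0 p' x /\ ~ A x.
  by move=> dx tx; apply: al => //; have := nth_gt0 tx; rewrite st.
have [fi' fis'] := frames_inv iS ep (extends_pad (red S) (size p')) (fun x dx d'x => False_ind _ (pad_new dx d'x)).
case: iS => [Hp [L [sd [sb [bd [dA [ch [fi fis]]]]]]]].
rewrite /inv /= size_pad ?sd // st; do 4 (split=> //).
split.
  by have := bits_pad (m := size p') _ bd; rewrite size_pad ?sd //; apply.
split; first by move=> x; rewrite nth_pad; apply: dA.
split; first exact: (chain_top (f := top S)) ch.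
split=> //; case: fi' => [wf [_ [_ [bA [rc _]]]]].
split=> //; split; first by rewrite /= st.
split; first by rewrite /= st.
split.
  move=> x tx; case: (ltnP x (size (bs (top S)))) => dx; last by case: (new x dx tx).
  by apply: bA; case: et => _ /(_ _ dx) <-.
split=> // j' /=; rewrite ltnS leq_eqVlt => /orP[/eqP ->|].
  by left; exists n, s.
case: fi => [_ [_ [_ [_ [_ bc]]]]] /bc; apply: blue_credit_extends => //=; first by rewrite sb.
by move=> x bx /(new _ bx) [].
Qed.

Lemma step_inv S S' : inv S -> step S S' -> inv S'.
Proof.
by move=> iS [H|[H|[H|H]]]; [apply: pops_inv H|apply: forces_inv H|apply: grows_red_inv H|apply: grows_blue_inv H].
Qed.

(** * Existence of a next step *)

Section Totality.
Hypothesis noncomp : forall i, noncomputable (C i).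

(** Otherwise the refuted pairs of values would always include the right pair and never the wrong
    one, and one of the two sets would be computable by [computable_from_pairs]. *)
Lemma exists_split S : exists n0 n1,
  let r := rq (top S) in let j := bj (top S) in
  live (lev (top S)).+1 (split_constraints S n0 n1 (value r n0) (value j n1)) (pre S) \/
  ~ live (lev (top S)).+1 (split_constraints S n0 n1 (1 - value r n0) (1 - value j n1)) (pre S).
Proof.
apply: NNPP => N.
have [] := @computable_from_pairs
  (fun n0 n1 v0 v1 => ~ live (lev (top S)).+1 (split_constraints S n0 n1 v0 v1) (pre S))
  (C (req_set (rq (top S)))) (C (req_set (bj (top S)))).
- apply: (semi_sub (f := fun z : nat * (nat * (nat * nat)) =>
    ((lev (top S)).+1, (split_constraints S z.1 z.2.1 z.2.2.1 z.2.2.2, pre S))) semi_not_live).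
  by rewrite /split_constraints; comp.
- by move=> n0 n1 H; apply: N; exists n0, n1; left.
- by move=> n0 n1 H; apply: N; exists n0, n1; right.
- exact: noncomp.
- exact: noncomp.
Qed.

Lemma step_total S : inv S -> exists S', step S S'.
Proof.
move=> iS; case: (iS) => [Hp [L [sd [sb [bd [dA [ch [[wf _] _]]]]]]]].
case: (classic (live (lev (top S)) (exhausted (lev (top S)) (pre S) :: cs (top S)) (pre S))) => Lx.
  case E: (stk S) ch => [|e es] /= ch; last by eexists; left; exists e, es; split; [|split].
  (* With an empty stack the level is 0, and every new position has level at least 0: the reservoir
     cannot be exhausted. *)
  have [s [/stringsP [s1 _] g]] := Lx 1.
  have := good_exhausted (x := size (pre S)) g (leqnn _).
  by rewrite size_cat s1 addn1 ltnSn ch => /(_ isT).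
have [l cert] : exists l, forall s, List.In s (strings (lev (top S)) l) ->
    ~ good (exhausted (lev (top S)) (pre S) :: cs (top S)) (pre S ++ s).
  apply: NNPP => N; apply: Lx => l; apply: NNPP => N'; apply: N; exists l => s I g.
  by apply: N'; exists s.
have enl k s m : List.In s (strings k m) -> l <= m -> enlarges S (pre S ++ s).
  move=> /stringsP [sm _] lm; split; first exact: extends_cat.
  by exists l; rewrite size_cat sm; split=> //; lia.
have strW k k' m s : k <= k' -> List.In s (strings k m) -> List.In s (strings k' m).
  move=> le /stringsP [<- a]; apply/stringsP; split=> //; apply: sub_all a => x; lia.
have ins k s m : lev (top S) <= k -> List.In s (strings k m) -> List.In (pre S ++ s) (strings k (size (pre S ++ s))).
  move=> le I; rewrite size_cat; apply: strings_cat; first exact: strW le Hp.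
  by case/stringsP: (I) => ->.
have [n0 [n1 [Lf|Ld]]] := exists_split S.
  have [s [I Ls]] := live_cat l Lf.
  eexists; right; left; exists (pre S ++ s), n0, n1; split; first exact: enl I _.
  split; first exact: ins (leqnSn _) I.
  by split; [exact: Ls|].
have [m bad] : exists m, forall s, List.In s (strings (lev (top S)).+1 m) ->
    ~ good (split_constraints S n0 n1 (1 - value (rq (top S)) n0) (1 - value (bj (top S)) n1)) (pre S ++ s).
  apply: NNPP => N; apply: Ld => m; apply: NNPP => N'; apply: N; exists m => s I g.
  by apply: N'; exists s.
(* The length covers both the certificate [l] of enlargement and the length [m] at which the two
   wrong values are refuted. *)
have [s [I Ls]] := live_cat (l + m) L.
set k := lev (top S) in strW ins Ld bad I Ls cert Hp L wf Lx enl *.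
set p' := pre S ++ s.
have ep' : enlarges S p' by apply: enl I _; lia.
have Ip' : List.In p' (strings k (size p')) by apply: ins I.
(* The partition by [A]: new elements of the reservoir that belong to [A] are raised to [k.+1]. *)
pose raise x := if (size (pre S) <= x) && (nth 0 p' x == k) && excluded_middle_informative (A x)
  then k.+1 else nth 0 p' x.
pose q := mkseq raise (size p').
have p'k x : nth 0 p' x <= k.
  case: (ltnP x (size p')) => lt; last by rewrite nth_default.
  by case/stringsP: Ip' => _ /(all_nthP 0) H; apply: H.
have raise_k x : raise x <= k.+1.
  rewrite /raise; case: ifP => // _; by apply: leq_trans (p'k x) _.
have qp' : map (minn k) q = p'.
  apply: (@eq_from_nth _ 0); rewrite size_map size_mkseq // => x lt.
  rewrite nth_min nth_mkseq // /raise; case: ifP => [/andP[/andP[_ /eqP ->] _]|_]; first lia.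
  by apply/minn_idPr.
have q_pre : q = pre S ++ drop (size (pre S)) q.
  apply: extendsE; split=> [|x lt]; first by rewrite size_mkseq size_cat leq_addr.
  rewrite nth_mkseq; last by rewrite size_cat; lia.
  by rewrite /raise leqNgt lt /= nth_cat lt.
have bad_q : ~ good (split_constraints S n0 n1 (1 - value (rq (top S)) n0) (1 - value (bj (top S)) n1)) q.
  rewrite q_pre -(cat_take_drop m (drop _ q)) catA => /good_cat; apply: bad.
  apply: (strings_take (m' := l + m) _ _).1; first by lia.
  apply/stringsP; split; first by rewrite size_drop size_mkseq size_cat; case/stringsP: I => ->; lia.
  apply/(all_nthP 0) => x; rewrite size_drop size_mkseq => lt; rewrite nth_drop nth_mkseq //; lia.
have good_q : good (cs (top S)) q by apply/(good_min _ wf); rewrite qp'; apply: live_good Ls.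
have sq : size q = size p' by rewrite size_mkseq.
have [c [Ic [t [It v]]]] : exists c,
    List.In c (split_constraints S n0 n1 (1 - value (rq (top S)) n0) (1 - value (bj (top S)) n1)) /\
    exists t, List.In t (strings 1 (size q)) /\ violates q c t.
  apply: NNPP => N; apply: bad_q => c Ic t It v; apply: N; exists c; split=> //; by exists t.
rewrite sq in It.
(* The old constraints hold on [q], so a split constraint is violated. For the red one the new
   elements of [t] were raised, hence are in [A]; for the blue one they kept the level [k], hence
   are outside [A]. *)
case: Ic => [E|[E|Ic]]; last by case: (good_q c Ic t) => //; rewrite sq.
- eexists; right; right; left; exists p', t; split=> //; split=> //; split=> //; split; last reflexivity.
  move: v; rewrite -E => -[/= et [al o]]; split=> //; split=> //; split; last by exists n0, (size q).
  move=> x xp dx tx; move: (al x); rewrite sq => /(_ xp dx tx) [/= + _].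
  rewrite nth_mkseq // /raise; case: ifP => [/andP[/andP[_ /eqP ->]]|_ H]; last by have := p'k x; lia.
  by case: excluded_middle_informative.
eexists; right; right; right; exists p', t; split=> //; split=> //; split=> //; split; last reflexivity.
move: v; rewrite -E => -[/= et [al o]]; split=> //; split=> //; split; last by exists n1, (size q).
move=> x xp dx tx; move: (al x); rewrite sq => /(_ xp dx tx) [/= _ [//|]].
rewrite nth_mkseq // /raise -sb dx /=; case: ifP => [_ H|+ H]; first by rewrite -/k in H; lia.
by rewrite -/k in H *; rewrite H eqxx /=; case: excluded_middle_informative.
Qed.
End Totality.
End Invariant.

(** * Analysis of the construction *)

Lemma extends_nth t u x : extends t u -> 0 < nth 0 t x -> nth 0 u x = nth 0 t x.
Proof. by move=> [_ H] /nth_gt0 /H. Qed.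

Lemma bits_le1 t m x : List.In t (strings 1 m) -> nth 0 t x <= 1.
Proof.
move=> /stringsP [_ /(all_nthP 0) H]; case: (ltnP x (size t)) => lt; first exact: H.
by rewrite nth_default.
Qed.

(** At most [m] ones fit below position [m]. *)
Lemma many_ones t m k : List.In t (strings 1 k) -> m < foldr addn 0 t -> exists x, m <= x /\ 0 < nth 0 t x.
Proof.
move=> /stringsP [_]; elim: t m {k} => //= a t IH [|m] /andP[a1 bt] lt.
  case: a a1 lt => [|a] _; last by exists 0.
  by rewrite add0n => /(IH _ bt) [x [_ tx]]; exists x.+1.
by have [|x [mx tx]] := IH m bt; [lia | exists x.+1].
Qed.

(** Post's theorem: the search runs until [P] or its negation is confirmed. *)
Lemma decidable_post {O T} {cT : coded T} (P : T -> Prop) :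
  semi O P -> semi O (fun x => ~ P x) -> decidable_in O P.
Proof.
move=> sP sN; apply/computable_chi.
apply: (semi_graph (Q := fun x a => (a = 1 /\ P x) \/ (a = 0 /\ ~ P x))).
- apply: semi_or; apply: semi_and.
  + by apply: semi_decidable; deciding.
  + by apply: (semi_sub sP); comp.
  + by apply: semi_decidable; deciding.
  + by apply: (semi_sub sN); comp.
- by move=> x; case: (classic (P x)) => p; [left; rewrite chi1 | right; rewrite chi0].
- by move=> x a [[-> p]|[-> p]]; apply/esym; [rewrite chi1 | rewrite chi0].
Qed.

(** * The set approximated by bit strings growing along a decidable set of stages *)

Section Conclusion.
Variables (C : nat -> nat -> Prop) (B : nat -> Prop) (I : nat -> Prop) (F : nat -> seq nat).
Hypotheses (dI : decidable_in halting_set I) (cF : computable halting_set F).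
Hypothesis bitsF : forall s, I s -> List.In (F s) (strings 1 (size (F s))).
Hypothesis monoF : forall s s', I s -> I s' -> s <= s' -> extends (F s) (F s').
Hypothesis longF : forall m, exists s, I s /\ m <= size (F s).
Hypothesis subF : forall s x, I s -> 0 < nth 0 (F s) x -> B x.
Hypothesis metF : forall r,
  (exists m n s, I m /\ outputs s (F m) r n (1 - value C r n)) \/
  (req_kind r <> 0 /\ exists n, forall m s, I m -> ~ outputs s (F m) r n (value C r n)).

Let X (x : nat) : Prop := exists s, I s /\ 0 < nth 0 (F s) x.

Lemma limit_eq s x : I s -> x < size (F s) -> nth 0 (F s) x = chi X x.
Proof.
move=> Is lt; have [E|E] : nth 0 (F s) x = 0 \/ nth 0 (F s) x = 1.
- by have := bits_le1 x (bitsF Is); lia.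
- rewrite E; apply/esym/chi0 => -[s' [Is' pos]].
  case/orP: (leq_total s s') => le.
    by have [_ /(_ _ lt)] := monoF Is Is' le; rewrite E => E'; rewrite E' in pos.
  by have := extends_nth (monoF Is' Is le) pos; rewrite E => E'; rewrite -E' in pos.
- by rewrite E; apply/esym/chi1; exists s; rewrite E.
Qed.

Lemma limit_delta02 : delta02 X.
Proof.
apply/turing_le_computable/computable_chi; apply: decidable_post.
  apply: semi_ex; apply: semi_decidable; deciding.
  by apply: (decidable_sub (P := I) dI); comp.
(* Non-membership is also confirmed at a finite stage, by a string long enough to show a 0 at
   [x]. *)
apply: (@semi_ext _ _ _ (fun x => exists s, I s /\ (x < size (F s) /\ nth 0 (F s) x = 0))).
  move=> x; split=> [[s [Is [lt E]]]|N].
    by apply/chi0; rewrite -(limit_eq Is lt).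
  have [s [Is le]] := longF x.+1; exists s; split=> //; split=> //.
  by rewrite limit_eq //; apply/chi0.
apply: semi_ex; apply: semi_decidable; deciding.
by apply: (decidable_sub (P := I) dI); comp.
Qed.

Lemma limit_infinite : infinite_set X.
Proof.
move=> m; have [] := metF (enc (0, (m.+1, 0))).
  move=> [s [n [u [Is [[_]|[]]]]]]; rewrite /req_kind /req_arg /= ?nsnd_npair ?nfst_npair //.
  by move=> /(many_ones (bitsF Is)) [x [mx pos]]; exists x; split=> //; exists s.
by rewrite /req_kind /= nfst_npair => -[].
Qed.

Lemma limit_avoids i : ~ turing_le (C i) X.
Proof.
move=> /turing_le_computable [c Hc]; set r := enc (1, (encode c, i)).
have vr n : value C r n = chi (C i) n by rewrite /value /req_set /r /= !nsnd_npair.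
have ar : req_arg r = encode c by rewrite /req_arg /r /= nsnd_npair nfst_npair.
have kr : req_kind r = 1 by rewrite /req_kind /r /= nfst_npair.
have [[s [n [u [Is [[]|[_ [D [_ [dD ID]]]]]]]]]|[_ [n N]]] := metF r; first by rewrite kr.
  have ag : agrees X (F s) (size (F s)) by split=> // x; apply: limit_eq.
  rewrite ar in ID; have := eval_det (derivation_eval ag dD ID) (Hc n).
  by rewrite vr /=; have := chi_le1 (C i) n; lia.
(* If the right value is never output, the true computation from [X] is a counterexample: its
   derivation is available once the string is longer than its use. *)
have [u [D [dD ID]]] := eval_derivation (Hc n).
have [s [Is le]] := longF u.
apply: (N s (enc D).+1 Is); right; rewrite kr; split=> //; exists (enc D); split=> //.
rewrite encK ar vr; split=> //; apply: dD; split=> // x lt; apply: limit_eq => //; exact: leq_trans lt le.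
Qed.

Lemma limit_set : exists X : nat -> Prop, subset_of X B /\ infinite_set X /\ delta02 X /\
  forall i, ~ turing_le (C i) X.
Proof.
exists X; split; first by move=> x [s [Is /(subF Is)]].
split; [exact: limit_infinite | split; [exact: limit_delta02 | exact: limit_avoids]].
Qed.
End Conclusion.

(** * Effect of one step on the strings, the constraints and the frames *)

Section Steps.
Variables (A : nat -> Prop) (C : nat -> nat -> Prop).
Local Notation value := (value C).
Local Notation step := (step A C).
Local Notation inv := (inv A C).

Definition frame_of (S : state) (f : frame) : Prop := f = top S \/ exists e, List.In e (stk S) /\ f = e.1.

Lemma top_frame S f : inv S -> frame_of S f -> rq (top S) <= rq f -> f = top S.
Proof.
move=> [_ [_ [_ [_ [_ [_ [ch _]]]]]]] [//|[e [Ie ->]]].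
by have [_ [lt _]] := chain_below ch Ie; rewrite leqNgt lt.
Qed.

Lemma frame_below S f : inv S -> frame_of S f -> lev f <= lev (top S) /\ frame_inv A C (pre S) (red S) f.
Proof.
move=> [_ [_ [_ [_ [_ [_ [ch [fi fis]]]]]]]] [->|[e [Ie ->]]]; first by [].
by have [lt _] := chain_below ch Ie; split; [apply: ltnW | apply: fis].
Qed.

Lemma step_enlarges S S' : step S S' ->
  pops S S' \/ enlarges S (pre S') /\ good (cs (top S)) (pre S').
Proof.
move=> [H|[H|[H|H]]]; [by left | right | right | right].
- move: H => [p' [n0 [n1 [en [_ [L ->]]]]]]; split=> //.
  by apply: good_sub (live_good L) => c I; right; right.
- by move: H => [p' [t [en [_ [L [_ ->]]]]]]; split=> //; apply: live_good L.
- by move: H => [p' [t [en [_ [L [_ ->]]]]]]; split=> //; apply: live_good L.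
Qed.

(** After truncation to the active level [p'] is still good, while the certificate excludes that it
    is good for the exhaustion constraint too. *)
Lemma enlarges_new S p' : inv S -> enlarges S p' -> good (cs (top S)) p' ->
  exists x, size (pre S) <= x /\ x < size p' /\ lev (top S) <= nth 0 p' x.
Proof.
move=> [Ip [_ [_ [_ [_ [_ [_ [[wf _] _]]]]]]]] [ep [l [le cert]]] g.
set k := lev (top S) in Ip wf cert *; set q := map (minn k) p'.
have gq : good (cs (top S)) q by apply: (iffLR (good_min p' wf) g).
have eq : extends (pre S) q.
  split; first by rewrite size_map; lia.
  move=> x lt; rewrite nth_min; case: ep => _ -> //; apply/minn_idPr.
  by case/stringsP: Ip => _ /(all_nthP 0); apply.
have ngq : ~ good (exhausted k (pre S) :: cs (top S)) q.
  rewrite (extendsE eq) -(cat_take_drop l (drop _ q)) catA => /good_cat; apply: cert.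
  apply/stringsP; split; first by rewrite size_takel // size_drop size_map; lia.
  apply/(all_nthP 0) => x; rewrite size_takel; last by rewrite size_drop size_map; lia.
  by move=> lt; rewrite nth_take // nth_drop nth_min; apply: geq_minl.
have [x [px [xq kx]]] := not_good_exhausted gq ngq.
exists x; split=> //; rewrite size_map in xq; split=> //.
by apply: leq_trans kx _; rewrite nth_min; apply: geq_minr.
Qed.

Lemma step_red S S' : inv S -> step S S' ->
  extends (red S) (red S') /\
  forall l base, l <= lev (top S) -> l <= lev (top S') -> fits l base (red S) (pre S) -> fits l base (red S') (pre S').
Proof.
move=> [_ [_ [sd _]]] [H|[H|[H|H]]].
- move: H => [e [es [_ [_ ->]]]] /=; split=> // l base _; exact: fits_min.
- move: H => [p' [n0 [n1 [[ep _] [_ [_ ->]]]]]] /=; split; first exact: extends_pad.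
  move=> l base le _ /fits_extends; apply=> //; rewrite ?sd //; first exact: extends_pad.
  by move=> x; rewrite -sd => dx /(pad_new dx).
- move: H => [p' [t [[ep _] [_ [_ [[et [It [al _]]] ->]]]]]] /=; split=> //.
  move=> l base le _ /fits_extends; apply=> //; rewrite ?sd // => x; rewrite -sd => dx tx.
  apply: leq_trans le _; apply: (al x _ dx tx).1.
  by case/stringsP: It => <- _; apply: nth_gt0.
- move: H => [p' [t [[ep _] [_ [_ [_ ->]]]]]] /=; split; first exact: extends_pad.
  move=> l base le _ /fits_extends; apply=> //; rewrite ?sd //; first exact: extends_pad.
  by move=> x; rewrite -sd => dx /(pad_new dx).
Qed.

Lemma step_constraint S S' r w : inv S -> step S S' -> r <= rq (top S) ->
  (forall f, frame_of S f -> r <= rq f -> List.In w (cs f)) ->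
  forall f, frame_of S' f -> r <= rq f -> List.In w (cs f).
Proof.
move=> iS [H|[H|[H|H]]] le K f.
- move: H => [e [es [E [_ ->]]]] [->|[e' [Ie' ->]]] /= rf.
    by right; apply: K => //; right; exists e; rewrite E; split=> //; left.
  by apply: K => //; right; exists e'; rewrite E; split=> //; right.
- move: H => [p' [n0 [n1 [_ [_ [_ ->]]]]]] [->|[e' [/= [<-|Ie'] ->]]] /= rf.
  + by right; right; apply: K => //; left.
  + by apply: K => //; left.
  + by apply: K => //; right; exists e'.
- move: H => [p' [t [_ [_ [_ [_ ->]]]]]] [->|[e' [Ie' ->]]] /= rf.
  + by apply: K => //; left.
  + by apply: K => //; right; exists e'.
- move: H => [p' [t [_ [_ [_ [_ ->]]]]]] [->|[e' [Ie' ->]]] /= rf.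
  + by apply: K => //; left.
  + by apply: K => //; right; exists e'.
Qed.

Definition frame_grows (p p' : seq nat) (f f' : frame) : Prop :=
  lev f' = lev f /\ extends (bs f) (bs f') /\ bj f <= bj f' /\
  forall base, fits (lev f) base (bs f) p -> fits (lev f) base (bs f') p'.

Lemma frame_grows_extends p p' f : extends p p' -> size (bs f) <= size p -> frame_grows p p' f f.
Proof.
move=> ep le; split=> //; split=> //; split=> // base; move/fits_extends; apply=> // x bx /nth_gt0.
by rewrite ltnNge bx.
Qed.

(** As [r <= rq (top S)], the steps [forces] and [grows_red] activate only later requirements. A
    frame on [r] becomes or stays active by resumption or blue growth, and both advance its blue
    requirement. *)
Lemma step_frame S S' r : inv S -> step S S' -> r <= rq (top S) ->
  forall f', frame_of S' f' -> rq f' = r ->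
  exists f, frame_of S f /\ rq f = r /\ frame_grows (pre S) (pre S') f f' /\
    (rq (top S') = r -> bj f < bj f').
Proof.
move=> iS st le f' Ff' rf'; have iS' := step_inv iS st.
have sus e : List.In e (stk S') -> lev e.1 < lev (top S') /\ rq e.1 < rq (top S').
  by move: iS' => [_ [_ [_ [_ [_ [_ [ch _]]]]]]] /(chain_below ch) [? []].
have old f : frame_of S f -> extends (pre S) (pre S') -> frame_grows (pre S) (pre S') f f.
  by move=> /(frame_below iS) [_ [_ [sb _]]] ep; apply: frame_grows_extends.
case: Ff' => [Ef'|[e' [Ie' Ef']]]; last first.
  have [le' lt'] := sus _ Ie'; rewrite -Ef' in le' lt'.
  have Ff : frame_of S f'.
    case: st => [H|[H|[H|H]]].
    - by move: H => [e [es [E [_ ES]]]]; subst S'; right; exists e'; rewrite E; split=> //; right.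
    - move: H => [p' [n0 [n1 [_ [_ [_ ES]]]]]]; subst S'; case: Ie' => [Ee|Ie'].
        by left; rewrite Ef' -Ee.
      by right; exists e'.
    - by move: H => [p' [t [_ [_ [_ [_ ES]]]]]]; subst S'; right; exists e'.
    - by move: H => [p' [t [_ [_ [_ [_ ES]]]]]]; subst S'; right; exists e'.
  exists f'; do 2 (split=> //); split; last by move=> E; rewrite E rf' ltnn in lt'.
  case: (step_enlarges st) => [[e [es [_ [_ ES]]]]|[[ep _] _]]; last exact: old.
  subst S'; split=> //; split=> //; split=> // base; apply: fits_min; exact: ltnW.
rewrite {f'}Ef' in rf' *.
case: st => [H|[H|[H|H]]].
- move: H => [e [es [E [_ ES]]]]; subst S'; rewrite /= in rf' *.
  have Fe : frame_of S e.1 by right; exists e; rewrite E; split=> //; left.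
  have [_ [_ [sb _]]] := frame_below iS Fe.
  exists e.1; do 2 (split=> //); split=> //; split=> //; split; first exact: extends_pad.
  split=> //= base H; apply: fits_min => //; apply: fits_extends H _ _ _ _ => //; first exact: extends_pad.
  by move=> x bx /(pad_new bx).
- move: H => [p' [n0 [n1 [_ [_ [_ ES]]]]]]; subst S'; rewrite /= in rf'.
  by rewrite -rf' ltnn in le.
- move: H => [p' [t [_ [_ [_ [_ ES]]]]]]; subst S'; rewrite /= in rf'.
  by rewrite -rf' ltnn in le.
- move: H => [p' [t [[ep _] [_ [_ [[et [It [al _]]] ES]]]]]]; subst S'; rewrite /= in rf' *.
  have [_ [_ [sb _]]] := frame_below iS (or_introl erefl : frame_of S (top S)).
  exists (top S); split; first by left.
  split=> //; split=> //; split=> //; split=> //; split=> //= base H.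
  apply: fits_extends H et ep sb _ => x bx tx; apply: (al x _ bx tx).1.
  by case/stringsP: It => <- _; apply: nth_gt0.
Qed.
End Steps.

(** * Growth along an infinite run *)

Section Run.
Variables (A : nat -> Prop) (C : nat -> nat -> Prop) (S : nat -> state).
Local Notation value := (value C).
Hypotheses (invS : forall s, inv A C (S s)) (stepS : forall s, step A C (S s) (S s.+1)).

Lemma size_pre s s' : s <= s' -> size (pre (S s)) <= size (pre (S s')).
Proof.
move=> /subnKC <-; elim: (s' - s) => [|n IH]; first by rewrite addn0.
rewrite addnS; apply: leq_trans IH _.
case: (step_enlarges (stepS (s + n))) => [[e [es [_ [_ ->]]]]|[[[le _] _] _]] //.
by rewrite /= size_map.
Qed.

(** Each resumption shortens the stack, so only finitely many occur in a row. *)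
Lemma enlarges_later s :
  exists s', s <= s' /\ enlarges (S s') (pre (S s'.+1)) /\ good (cs (top (S s'))) (pre (S s'.+1)).
Proof.
move: {2}(size _) (leqnn (size (stk (S s)))) => n; elim: n s => [|n IH] s le;
  case: (step_enlarges (stepS s)) => [[e [es [E [_ ES]]]]|H]; try (by exists s); rewrite E //= in le *.
have [|s' [ss' H]] := IH s.+1; first by rewrite ES.
by exists s'; split=> //; apply: ltnW.
Qed.

Lemma size_pre_unbounded m : exists s, m <= size (pre (S s)).
Proof.
elim: m => [|m [s le]]; first by exists 0.
have [s' [ss' [en g]]] := enlarges_later s.
have [x [x1 [x2 _]]] := enlarges_new (invS s') en g.
by exists s'.+1; have := size_pre ss'; lia.
Qed.

Lemma extends_red s s' : s <= s' -> extends (red (S s)) (red (S s')).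
Proof.
move=> /subnKC <-; elim: (s' - s) => [|n IH]; first by rewrite addn0.
by rewrite addnS; apply: extends_trans IH (step_red (invS _) (stepS _)).1.
Qed.

Definition weight (l b : nat) (p : seq nat) : nat := \sum_(i < size p) ((b <= i) && (l <= nth 0 p i)).

Lemma weight_min l b p k : l <= k -> weight l b (map (minn k) p) = weight l b p.
Proof.
move=> le; rewrite /weight size_map; apply: eq_bigr => i _; rewrite nth_min; congr (nat_of_bool (_ && _)).
by rewrite leq_min le.
Qed.

Lemma weight_extends l b p p' : extends p p' -> weight l b p <= weight l b p' /\
  forall x, b <= x -> size p <= x -> x < size p' -> l <= nth 0 p' x -> weight l b p < weight l b p'.
Proof.
move=> [le H]; rewrite /weight -!(big_mkord xpredT (fun i => nat_of_bool ((b <= i) && (l <= nth 0 _ i)))).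
have E : \sum_(0 <= i < size p) ((b <= i) && (l <= nth 0 p i)) = \sum_(0 <= i < size p) ((b <= i) && (l <= nth 0 p' i)).
  by apply: eq_big_nat => i /andP[_ lt]; rewrite H.
rewrite (big_cat_nat (n := size p) (p := size p')) //= E.
split=> [|x bx px xp' lx]; first exact: leq_addr.
rewrite -[X in X < _]addn0 ltn_add2l (big_cat_nat (n := x)) //=; last exact: ltnW.
by rewrite (big_ltn xp') bx lx; lia.
Qed.

(* A "many elements" requirement that stays forbidden on a reservoir would bound its size, although every step
   other than a resumption adds an element to it. *)
Lemma cardinality_not_forbidden s1 l base r n v : req_kind r = 0 -> all (fun a => a <= 1) base ->
  size base <= size (pre (S s1)) ->
  ~ forall s, s1 <= s -> List.In (l, (0, (base, (r, (n, v))))) (cs (top (S s))).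
Proof.
move=> kr bits sb H; set w := weight l (size base).
have lev_l s : s1 <= s -> l <= lev (top (S s)).
  by move=> /H I; have [_ [_ [_ [_ [_ [_ [_ [[wf _] _]]]]]]]] := invS s; case: (wf _ I).
have mono s s' : s1 <= s -> s <= s' -> w (pre (S s)) <= w (pre (S s')).
  move=> le /subnKC <-; elim: (s' - s) => [|m IH]; first by rewrite addn0.
  rewrite addnS; apply: leq_trans IH _; have le2 : s1 <= (s + m).+1 by lia.
  case: (step_enlarges (stepS (s + m))) => [[e [es [_ [_ E]]]]|[[ep _] _]]; last by apply: (weight_extends _ _ ep).1.
  by have := lev_l _ le2; rewrite E /= => ?; rewrite /w weight_min.
have [s [le big]] : exists s, s1 <= s /\ req_arg r <= w (pre (S s)).
  elim: (req_arg r) => [|m [s [le wm]]]; first by exists s1.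
  have [s' [ss' [en g]]] := enlarges_later s.
  have [x [x1 [x2 x3]]] := enlarges_new (invS s') en g.
  exists s'.+1; split; first by lia.
  apply: leq_ltn_trans (leq_trans wm (mono _ _ le ss')) _.
  apply: (weight_extends _ _ (proj1 en)).2 x2 _ => //.
    by apply: leq_trans sb (leq_trans (size_pre _) x1); lia.
  by apply: leq_trans x3; apply: lev_l; lia.
have [_ [L [_ _]]] := invS s; set p := pre (S s) in L big.
have sbp : size base <= size p by apply: leq_trans sb (size_pre le).
(* All available elements of level at least [l] are taken at once; by [big] they are numerous enough
   to violate the constraint. *)
pose t := base ++ mkseq (fun i => nat_of_bool (l <= nth 0 p (size base + i))) (size p - size base).
have st : size t = size p by rewrite size_cat size_mkseq subnKC.
apply: (live_good L (H s le) (t := t)).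
  apply/stringsP; split=> //; rewrite all_cat bits; apply/(all_nthP 0) => i; rewrite size_mkseq => lt.
  by rewrite nth_mkseq // leq_b1.
split; first exact: extends_cat.
split=> [x xp /= bx|]; last first.
  left; split=> //=; apply: leq_trans big _.
  rewrite foldr_cat /w /weight -(big_mkord xpredT (fun i => nat_of_bool ((size base <= i) && (l <= nth 0 p i)))).
  rewrite (big_cat_nat (n := size base)) //= big_nat_cond big1 ?add0n; last first.
    by move=> i /andP[/andP[_ lt] _]; rewrite leqNgt lt.
  rewrite -{1}(add0n (size base)) big_addn.
  have le_foldr (q : seq nat) z : z <= foldr addn z q by elim: q => //= a q IH; apply: leq_trans IH (leq_addl _ _).
  apply: leq_trans (le_foldr base _).
  rewrite -/(sumn _) sumnE big_map -/(index_iota 0 _) /index_iota subn0.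
  by apply: leq_sum => i _; rewrite leq_addl addnC.
have -> : nth 0 t x = (l <= nth 0 p x).
  by rewrite nth_cat (ltnNge x) bx /= nth_mkseq ?subnKC //; lia.
by rewrite /allowed /=; case: (l <= _) => // _; split=> //; left.
Qed.
End Run.

(** * Success of the red set or of a blue set *)

Section Outcome.
Variables (A : nat -> Prop) (C : nat -> nat -> Prop) (S : nat -> state).
Local Notation value := (value C).
Hypotheses (invS : forall s, inv A C (S s)) (stepS : forall s, step A C (S s) (S s.+1)).
Hypothesis cS : computable halting_set S.

Lemma constraint_persists s1 r w : (forall s, s1 <= s -> r <= rq (top (S s))) ->
  (forall f, frame_of (S s1) f -> r <= rq f -> List.In w (cs f)) ->
  forall s, s1 <= s -> forall f, frame_of (S s) f -> r <= rq f -> List.In w (cs f).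
Proof.
move=> H H1 s /subnKC <-; elim: (s - s1) => [|m IH]; first by rewrite addn0.
rewrite addnS; apply: step_constraint (invS _) (stepS _) _ IH; apply: H; exact: leq_addr.
Qed.

(** At stage [s1] the only frame whose requirement is at least the active one is the active frame
    itself, so [w] is in force in all frames concerned, and it stays so while no earlier requirement
    returns. *)
Lemma top_constraint_persists s1 w : (forall s, s1 <= s -> rq (top (S s1)) <= rq (top (S s))) ->
  List.In w (cs (top (S s1))) -> forall s, s1 <= s -> List.In w (cs (top (S s))).
Proof.
move=> H I s le; apply: (constraint_persists H _ le); [|by left|exact: H].
by move=> f Ff /(top_frame (invS s1) Ff) ->.
Qed.

Lemma forbidden_output s l base r n v t : List.In (l, (0, (base, (r, (n, v))))) (cs (top (S s))) ->
  fits l base t (pre (S s)) -> List.In t (strings 1 (size (pre (S s)))) -> ~ outputs (size (pre (S s))) t r n v.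
Proof.
move=> I [ext new] It o; have [_ [L _]] := invS s.
apply: (live_good L I It); split=> //; split=> //= x xp bx tx.
by split; [apply: new | left].
Qed.

Lemma constraint_level s c : List.In c (cs (top (S s))) -> c_lo c <= lev (top (S s)).
Proof. by move=> I; have [_ [_ [_ [_ [_ [_ [_ [[wf _] _]]]]]]]] := invS s; case: (wf _ I). Qed.

Lemma red_bits s : List.In (red (S s)) (strings 1 (size (red (S s)))).
Proof. by have [_ [_ [_ [_ []]]]] := invS s. Qed.

Lemma size_red s : size (red (S s)) = size (pre (S s)).
Proof. by have [_ [_ []]] := invS s. Qed.

Lemma size_blue s : size (bs (top (S s))) = size (pre (S s)).
Proof. by have [_ [_ [_ []]]] := invS s. Qed.

Lemma extends_bits s t : extends s t -> List.In t (strings 1 (size t)) -> all (fun a => a <= 1) s.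
Proof. by move=> /extendsE E /stringsP [_]; rewrite E all_cat => /andP[]. Qed.

Lemma red_outcome : (forall r, exists s0, forall s, s0 <= s -> r < rq (top (S s))) ->
  exists X : nat -> Prop, subset_of X A /\ infinite_set X /\ delta02 X /\ forall i, ~ turing_le (C i) X.
Proof.
move=> lim; apply: (@limit_set C A (fun _ => True) (fun s => red (S s))).
- exact: decidable_cst.
- by comp.
- by move=> s _; apply: red_bits.
- by move=> s s' _ _; apply: extends_red.
- by move=> m; have [s le] := size_pre_unbounded invS stepS m; exists s; rewrite size_red.
- by move=> s x _; have [_ [_ [_ [_ [_ [dA _]]]]]] := invS s; apply: dA.
move=> r; have [s0 H0] := lim r.
(* At a stage after [s0] where the active requirement is least, the constraints in force are in
   force forever. *)
have [s1 [le1 min1]] : exists s1, s0 <= s1 /\ forall s, s0 <= s -> rq (top (S s1)) <= rq (top (S s)).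
  have [v [[s1 [le1 Ev]] minv]] : exists v, (exists s, s0 <= s /\ rq (top (S s)) = v) /\
      forall u, u < v -> ~ exists s, s0 <= s /\ rq (top (S s)) = u.
    by apply: (@least (fun v => exists s, s0 <= s /\ rq (top (S s)) = v)); exists (rq (top (S s0))), s0.
  exists s1; split=> // s le; rewrite Ev leqNgt; apply/negP => /minv; apply; by exists s.
have [_ [_ [_ [_ [_ [_ [_ [[_ [_ [_ [_ [rc _]]]]] _]]]]]]]] := invS s1.
have [[n [u o]]|[n [l [base [I fit]]]]] := rc r (H0 _ le1); first by left; exists s1, n, u.
have K := top_constraint_persists (fun s le => min1 s (leq_trans le1 le)) I.
right; split.
  move=> k0; apply: (cardinality_not_forbidden invS stepS k0 (extends_bits fit.1 (red_bits s1)) _ K).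
  by rewrite -size_red; case: fit.1.
have fits_later s : s1 <= s -> fits l base (red (S s)) (pre (S s)).
  move=> /subnKC <-; elim: (s - s1) => [|m IH]; first by rewrite addn0.
  rewrite addnS; apply: (step_red (invS _) (stepS _)).2 IH.
    by apply: (constraint_level (K _ _)); lia.
  by apply: (constraint_level (K _ _)); lia.
exists n => m u _ o.
have [s le] := size_pre_unbounded invS stepS u.
(* An output with derivation bound [u] would still be present at this later stage, whose string is
   long enough to make it a violation. *)
have le2 : size (pre (S s)) <= size (pre (S (s1 + m + s))) by apply: size_pre => //; lia.
apply: (forbidden_output (K (s1 + m + s) _) (fits_later (s1 + m + s) _) _); try lia.
  by have := red_bits (s1 + m + s); rewrite size_red.
apply: outputs_mono o; first exact: leq_trans le le2.
by apply: extends_red => //; lia.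
Qed.

Lemma frame_grows_trans p p' p'' f f' f'' : frame_grows p p' f f' -> frame_grows p' p'' f' f'' ->
  frame_grows p p'' f f''.
Proof.
move=> [l1 [e1 [j1 F1]]] [l2 [e2 [j2 F2]]]; split; first by rewrite l2.
split; first exact: extends_trans e1 e2.
by split=> [|base /F1]; [apply: leq_trans j1 j2 | rewrite -l1; apply: F2].
Qed.

Lemma frame_tracked r s1 : (forall s, s1 <= s -> r <= rq (top (S s))) -> rq (top (S s1)) = r ->
  forall s, s1 <= s -> forall f, frame_of (S s) f -> rq f = r ->
  frame_grows (pre (S s1)) (pre (S s)) (top (S s1)) f /\
  (s1 < s -> rq (top (S s)) = r -> bj (top (S s1)) < bj f).
Proof.
move=> H E s /subnKC <-; elim: (s - s1) => [|m IH] f Ff rf.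
  rewrite addn0 in Ff *; rewrite ltnn; split=> //.
  by rewrite (top_frame (invS s1) Ff) ?rf ?E.
rewrite addnS in Ff *.
have [f0 [Ff0 [rf0 [g lt]]]] := step_frame (invS _) (stepS _) (H _ (leq_addr _ _)) Ff rf.
have [g0 _] := IH _ Ff0 rf0.
split; first exact: frame_grows_trans g0 g.
by move=> _ /lt; apply: leq_ltn_trans; case: g0 => _ [_ []].
Qed.

(** The blue string is read at the stages where [r] is active, a decidable set of stages; between
    two of them its frame may be suspended, but its string is never discarded. *)
Lemma blue_outcome r s1 : (forall s, s1 <= s -> r <= rq (top (S s))) ->
  (forall s0, exists s, s0 <= s /\ rq (top (S s)) = r) ->
  exists X : nat -> Prop, subset_of X (complement A) /\ infinite_set X /\ delta02 X /\ forall i, ~ turing_le (C i) X.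
Proof.
move=> H io.
have track s s' : s1 <= s -> rq (top (S s)) = r -> s <= s' -> rq (top (S s')) = r ->
    frame_grows (pre (S s)) (pre (S s')) (top (S s)) (top (S s')) /\ (s < s' -> bj (top (S s)) < bj (top (S s'))).
  move=> le E le' E'; have [|g lt] := @frame_tracked r s _ E s' le' (top (S s')) (or_introl erefl) E'.
    by move=> t st; apply: H; apply: leq_trans st.
  by split=> // ss'; apply: lt.
(* The blue requirement advances strictly between two visits of [r], so each one is eventually
   passed. *)
have bj_unbounded j : exists s, s1 <= s /\ rq (top (S s)) = r /\ j <= bj (top (S s)).
  elim: j => [|j [s [le [E jb]]]]; first by have [s [le E]] := io s1; exists s.
  have [s' [le' E']] := io s.+1; exists s'; split; first by lia.
  by split=> //; apply: leq_ltn_trans jb _; apply: (track s s' le E (ltnW le') E').2.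
apply: (@limit_set C (complement A) (fun s => s1 <= s /\ rq (top (S s)) = r) (fun s => bs (top (S s)))).
- by deciding.
- by comp.
- by move=> s _; have [_ [_ [_ [_ [_ [_ [_ [[_ [_ [b _]]] _]]]]]]]] := invS s.
- by move=> s s' [le E] [_ E'] le'; have [[_ [e _]] _] := track _ _ le E le' E'.
- move=> m; have [s le] := size_pre_unbounded invS stepS m.
  have [s' [le' E']] := io (s1 + s); exists s'; split; first by split=> //; lia.
  by rewrite size_blue; apply: leq_trans le (size_pre stepS _); lia.
- by move=> s x _; have [_ [_ [_ [_ [_ [_ [_ [[_ [_ [_ [bA _]]]] _]]]]]]]] := invS s; apply: bA.
move=> j; have [s2 [le2 [E2 jb]]] := bj_unbounded j.+1.
have [_ [_ [_ [_ [_ [_ [_ [[_ [_ [bb [_ [_ bc]]]]] _]]]]]]]] := invS s2.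
have [[n [u o]]|[n [base [I fit]]]] := bc j jb; first by left; exists s2, n, u.
have K : forall s, s2 <= s -> List.In (lev (top (S s2)), (0, (base, (j, (n, value j n))))) (cs (top (S s))).
  by apply: top_constraint_persists I => s le; rewrite E2; apply: H; apply: leq_trans le2 le.
right; split.
  move=> k0; apply: (cardinality_not_forbidden invS stepS k0 (extends_bits fit.1 bb) _ K).
  by rewrite -size_blue; case: fit.1.
exists n => m u [lem Em] o.
have [s le] := size_pre_unbounded invS stepS u.
have [s' [le' E']] := io (s2 + m + s).
have [[_ [_ [_ F]]] _] := track s2 s' le2 E2 (ltac:(lia)) E'.
have [[_ [em _]] _] := track m s' lem Em (ltac:(lia)) E'.
apply: (forbidden_output (K s' _) (F _ fit)); first lia.
  have [_ [_ [_ [_ [_ [_ [_ [[_ [_ [b _]]] _]]]]]]]] := invS s'.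
  by rewrite -size_blue.
apply: outputs_mono em o; apply: leq_trans le (size_pre stepS _); lia.
Qed.
End Outcome.

Theorem theorem4p5 (A : nat -> Prop) (C : nat -> nat -> Prop) :
  delta02 A ->
  uniformly_delta02 C ->
  (forall i, noncomputable (C i)) ->
  exists X : nat -> Prop,
    (subset_of X A \/ subset_of X (complement A)) /\
    infinite_set X /\ delta02 X /\
    (forall i, ~ turing_le (C i) X).
Proof.
move=> /turing_le_computable/computable_chi dA [c Hc] nc.
have cC : computable halting_set (fun z : nat * nat => chi (C z.1) z.2).
  exists c => -[i n]; rewrite /chi; case: excluded_middle_informative => p.
    exact: (Hc i n).1.
  exact: (Hc i n).2.
(* The reservoir of level 0 consists of all numbers and no constraint is in force. *)
pose init : state := ([::], ([::], ((0, (0, ([::], (0, [::])))), [::]))).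
have inv0 : inv A C init.
  split; first by left.
  split; first by move=> m; exists (nseq m 0); split; [exact: strings_nseq|].
  do 2 (split=> //); split; first by left.
  split; first by move=> x; rewrite nth_nil.
  do 2 (split=> //); split=> //; split=> //; split; first by left.
  by split; first by move=> x; rewrite nth_nil.
have [S [cS [_ H]]] := computable_run (semi_step_relation dA cC) inv0 (step_total nc) (@step_inv A C).
have invS s : inv A C (S s) by case: (H s).
have stepS s : step A C (S s) (S s.+1) by case: (H s).
case: (classic (forall r, exists s0, forall s, s0 <= s -> r < rq (top (S s)))) => lim.
  by have [X [XA HX]] := red_outcome invS stepS cS lim; exists X; split; [left|].
(* The least requirement that is not left behind for good: earlier ones are, so the active
   requirement is eventually at least [r], and it equals [r] infinitely often. *)
have [r [io minr]] : exists r, (~ exists s0, forall s, s0 <= s -> r < rq (top (S s))) /\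
    forall r', r' < r -> ~ ~ exists s0, forall s, s0 <= s -> r' < rq (top (S s)).
  by apply: (@least (fun r => ~ exists s0, forall s, s0 <= s -> r < rq (top (S s)))); apply: not_all_ex_not.
have [s1 ge] : exists s1, forall s, s1 <= s -> r <= rq (top (S s)).
  by case: (r) minr => [|r'] minr; [exists 0 | apply: NNPP; apply: minr].
have [|X [XA HX]] := blue_outcome invS stepS cS ge; last by exists X; split; [right|].
move=> s0; apply: NNPP => N; apply: io; exists (s0 + s1) => s le.
rewrite ltn_neqAle ge ?andbT; last by lia.
by apply/eqP => E; apply: N; exists s; split=> //; lia.
Qed.
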